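(* Let $\lambda=(\lambda_1,\dots,\lambda_r)$ be a partition of length $r\le n$. (1) $HP^{\mathbb L}_\lambda(x_1,\dots,x_n;t)$ is the coefficient of $u_1^{-\lambda_1}\cdots u_r^{-\lambda_r}$ in $$\prod_{i=1}^r\Big(\frac{u_i}{u_i+_{\mathbb L}[t](\bar u_i)}\cdot\frac1{\mathscr P(u_i)}\prod_{j=1}^n\frac{u_i+_{\mathbb L}[t](\bar x_j)}{u_i+_{\mathbb L}\bar x_j}\Big)\prod_{1\le i<j\le r}\frac{u_j+_{\mathbb L}\bar u_i}{u_j+_{\mathbb L}[t](\bar u_i)}.$$ (2) $HQ^{\mathbb L}_\lambda(x_1,\dots,x_n;t)$ is the coefficient of $u_1^{-\lambda_1}\cdots u_r^{-\lambda_r}$ in $$\prod_{i=1}^r\Big(\frac1{\mathscr P(u_i)}\prod_{j=1}^n\frac{u_i+_{\mathbb L}[t](\bar x_j)}{u_i+_{\mathbb L}\bar x_j}\Big)\prod_{1\le i<j\le r}\frac{u_j+_{\mathbb L}\bar u_i}{u_j+_{\mathbb L}[t](\bar u_i)}.$$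
   Context: $\mathbb L$ Lazard ring, $F_{\mathbb L}(u,v)=u+v+\sum_{i,j\ge1}a_{i,j}u^iv^j$ universal formal group law, $u+_{\mathbb L}v:=F_{\mathbb L}(u,v)$, $\bar u$ formal inverse, $\mathscr P(z):=1+\sum_{i\ge1}a_{i,1}z^i$; $\ell_{\mathbb L}$ the logarithm of $F_{\mathbb L}$ and $[t](x):=\ell_{\mathbb L}^{-1}(t\,\ell_{\mathbb L}(x))$ for an indeterminate $t$ (coefficients in $(\mathbb L\otimes\mathbb Q)[[t]]$). $[x;t]^k:=(x+_{\mathbb L}[t](\bar x))x^{k-1}$. $x_1,\dots,x_n$ indeterminates. $HP^{\mathbb L}_\lambda(x_1,\dots,x_n;t):=\sum_{\bar w\in S_n/(S_1)^r\times S_{n-r}}w\cdot\big[\prod_{i=1}^rx_i^{\lambda_i}\prod_{i=1}^r\prod_{j=i+1}^n\frac{x_i+_{\mathbb L}[t](\bar x_j)}{x_i+_{\mathbb L}\bar x_j}\big]$; $HQ^{\mathbb L}_\lambda$ likewise with $x_i^{\lambda_i}$ replaced by $[x_i;t]^{\lambda_i}$ ($S_n$ permutes the $x$'s; sum over coset representatives). Expansion convention: expand in powers of $x_1,\dots,x_n$ (denominators $u_i+_{\mathbb L}\bar x_j$ in powers of $x_j$); $u_i/(u_i+_{\mathbb L}[t](\bar u_i))$ and $1/\mathscr P(u_i)$ are power series in $u_i$; for $i<j$, $1/(u_j+_{\mathbb L}[t](\bar u_i))$ is expanded in powers of $u_i$ with coefficients Laurent in $u_j$. *)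

(* Defs.v *)
From HB Require Import structures.
From mathcomp Require Import all_boot all_order all_algebra all_fingroup.
From Stdlib Require Import ClassicalEpsilon.
Set Implicit Arguments. Unset Strict Implicit. Unset Printing Implicit Defensive.
Import Order.TTheory GRing.Theory Num.Theory.
Local Open Scope ring_scope.

Section IteratedLaurent.
Variable R : comNzRingType.

(* LT k = R((y_1))((y_2))...((y_k)): an element of LT k.+1 is the function
   giving, for each exponent of the (smallest) variable y_(k+1), its
   coefficient in LT k.  Elements we use are bounded below at every level. *)
Fixpoint LT (k : nat) : Type :=
  match k with 0 => R | k'.+1 => int -> LT k' end.

Fixpoint lzero (k : nat) : LT k :=
  match k return LT k with 0 => 0 | k'.+1 => fun _ => lzero k' end.

Fixpoint lcst (k : nat) (a : R) : LT k :=
  match k return LT k with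
  | 0 => a | k'.+1 => fun n => if n == 0 then lcst k' a else lzero k' end.

Definition lone (k : nat) : LT k := lcst k 1.

Fixpoint ladd (k : nat) : LT k -> LT k -> LT k :=
  match k return LT k -> LT k -> LT k with
  | 0 => fun a b => a + b
  | k'.+1 => fun f g n => ladd (f n) (g n) end.

Fixpoint lopp (k : nat) : LT k -> LT k :=
  match k return LT k -> LT k with
  | 0 => fun a => - a
  | k'.+1 => fun f n => lopp (f n) end.

Definition lbnd (A : Type) (z : A) (f : int -> A) : int :=
  epsilon (inhabits 0) (fun b : int => forall n : int, n < b -> f n = z).

Definition tonat (z : int) : nat := match z with Posz k => k | Negz _ => 0%N end.

(* Cauchy product of Laurent series (correct on series bounded below) *)
Fixpoint lmul (k : nat) : LT k -> LT k -> LT k :=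
  match k return LT k -> LT k -> LT k with
  | 0 => fun a b => a * b
  | k'.+1 => fun f g n =>
      let bf := lbnd (lzero k') f in
      let bg := lbnd (lzero k') g in
      foldr (@ladd k') (lzero k')
        [seq lmul (f (bf + Posz i)) (g (n - bf - Posz i))
        | i : nat <- iota 0 (tonat (n - bf - bg + 1))]
  end.

Definition lsumL (k : nat) (s : seq (LT k)) : LT k := foldr (@ladd k) (lzero k) s.
Definition lprodL (k : nat) (s : seq (LT k)) : LT k := foldr (@lmul k) (lone k) s.
Definition lexp (k : nat) (f : LT k) (j : nat) : LT k := iter j (lmul f) (lone k).

Fixpoint lwf (k : nat) : LT k -> Prop :=
  match k return LT k -> Prop with
  | 0 => fun _ => True
  | k'.+1 => fun f => (exists b : int, forall n : int, n < b -> f n = lzero k')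
                      /\ forall n, lwf (f n) end.

(* multiplicative inverse (the unique well-formed one, when it exists) *)
Definition linv (k : nat) (f : LT k) : LT k :=
  epsilon (inhabits (lzero k)) (fun g => lwf g /\ lmul f g = lone k).

Fixpoint isum (k : nat) : (nat -> LT k) -> LT k :=
  match k return (nat -> LT k) -> LT k with
  | 0 => fun s => epsilon (inhabits 0)
           (fun a : R => exists N, forall M, (N <= M)%N -> \sum_(j < M) s j = a)
  | k'.+1 => fun s n => isum (fun j => s j n) end.

(* the variable y_l in LT k (1 <= l <= k) *)
Fixpoint lvar (k : nat) (l : nat) : LT k :=
  match k return LT k with
  | 0 => 0
  | k'.+1 => if l == k'.+1 then (fun n => if n == 1 then lone k' else lzero k')
             else (fun n => if n == 0 then lvar k' l else lzero k') end.

Fixpoint coef (k : nat) : LT k -> (nat -> int) -> R :=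
  match k return LT k -> (nat -> int) -> R with
  | 0 => fun a _ => a
  | k'.+1 => fun f e => coef (f (e k'.+1)) e end.

Definition lsubst (k : nat) (c : nat -> R) (g : LT k) : LT k :=
  isum (fun j => lmul (lcst k (c j)) (lexp g j)).

Variable m : nat -> R.

Definition logc (j : nat) : R := match j with 0 => 0 | 1 => 1 | j'.+2 => m j' end.

Definition expc : nat -> R :=
  epsilon (inhabits (fun _ => 0))
    (fun e => e 0%N = 0 /\ lsubst e (lsubst logc (lvar 1 1)) = lvar 1 1).

Definition llog (k : nat) (g : LT k) : LT k := lsubst logc g.
Definition lexpo (k : nat) (h : LT k) : LT k := lsubst expc h.

Definition fgl (k : nat) (a b : LT k) : LT k := lexpo (ladd (llog a) (llog b)).
Definition fbar (k : nat) (a : LT k) : LT k := lexpo (lopp (llog a)).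
(* [t](a); the indeterminate t is always the variable y_1 *)
Definition tmul (k : nat) (a : LT k) : LT k := lexpo (lmul (lvar k 1) (llog a)).

Definition acoef (i : nat) : R :=
  coef (fgl (lvar 2 1) (lvar 2 2)) (fun l => if l == 1%N then (i : int) else 1).

Definition Pser (k : nat) (z : LT k) : LT k :=
  ladd (lone k) (isum (fun i => if i == 0%N then lzero k
                                else lmul (lcst k (acoef i)) (lexp z i))).

Definition ratio (k : nat) (a b : LT k) : LT k :=
  lmul (fgl a (tmul (fbar b))) (linv (fgl a (fbar b))).

Definition tpow (k : nat) (a : LT k) (j : nat) : LT k :=
  lmul (fgl a (tmul (fbar a))) (lexp a j.-1).

(* w is the representative of its coset w (S_1^r x S_(n-r)) that is
   increasing on the positions r+1..n *)
Definition cosetrep (n r : nat) (w : 'S_n) : bool :=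
  [forall i : 'I_n, forall j : 'I_n, ((r <= i)%N && (i < j)%N) ==> (w i < w j)%N].

Definition HL (n : nat) (lam : seq nat) (mono : LT n.+1 -> nat -> LT n.+1)
    : LT n.+1 :=
  let r := size lam in
  let x (i : 'I_n) := lvar n.+1 (i.+2) in
  lsumL [seq lmul
           (lprodL [seq mono (x (w i)) (nth 0%N lam i) | i : 'I_n <- enum 'I_n & (i < r)%N])
           (lprodL [seq ratio (x (w p.1)) (x (w p.2))
                   | p : 'I_n * 'I_n <- [seq (i, j) | i <- enum 'I_n, j <- enum 'I_n]
                   & ((p.1 < r)%N && (p.1 < p.2)%N)])
        | w : 'S_n <- enum [pred w : 'S_n | cosetrep r w]].

Definition HPL (n : nat) (lam : seq nat) : LT n.+1 := @HL n lam (@lexp n.+1).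
Definition HQL (n : nat) (lam : seq nat) : LT n.+1 := @HL n lam (@tpow n.+1).

(* ---- generating functions: ring LT (r+n).+1 with variables (from the
   largest to the smallest) t = y_1, u_r = y_2, ..., u_1 = y_(r+1),
   x_1 = y_(r+2), ..., x_n = y_(r+n+1).  Thus 1/(u_i +_L \bar x_j) is expanded
   in powers of x_j, and for i<j 1/(u_j +_L [t](\bar u_i)) in powers of u_i. *)
Definition GenF (n : nat) (lam : seq nat) (withfirst : bool) : LT (size lam + n).+1 :=
  let r := size lam in
  let K := (r + n).+1 in
  let u (i : nat) : LT K := lvar K (r.+1 - i) in      (* u_(i+1), i < r *)
  let x (j : nat) : LT K := lvar K (r.+2 + j) in      (* x_(j+1), j < n *)
  lmul
   (lprodL [seq lmul (lmul (if withfirst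
                            then lmul (u i) (linv (fgl (u i) (tmul (fbar (u i)))))
                            else lone K)
                           (linv (Pser (u i))))
                     (lprodL [seq ratio (u i) (x j) | j <- iota 0 n])
           | i <- iota 0 r])
   (lprodL [seq lmul (fgl (u p.2) (fbar (u p.1)))
                     (linv (fgl (u p.2) (tmul (fbar (u p.1)))))
           | p <- [seq (i, j) | i <- iota 0 r, j <- iota 0 r] & (p.1 < p.2)%N]).

End IteratedLaurent.

(* exponent vector of the generating-function ring corresponding to the
   monomial t^(e 1) u_1^(-lam_1) ... u_r^(-lam_r) x_1^(e 2) ... x_n^(e (n+1)) *)
Definition uexp (lam : seq nat) (e : nat -> int) (l : nat) : int :=
  let r := size lam in
  if (l <= 1)%N then e l
  else if (l <= r.+1)%N then - ((nth 0%N lam (r.+1 - l)%N : nat) : int)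
  else e (l - r)%N.

(* Main.v *)
(* Partial fractions: a series G regular in u satisfies
     [u^-k] G(u) / prod_j (u - x_j) = sum_j G(x_j) x_j^(k-1) / prod_(l <> j) (x_j - x_l)   (k >= 1).
   Each u +_L bar x_j is (u - x_j) h_j with h_j a unit and h_j(x_j) = 1/P(x_j), because P = exp' o log is
   the derivative of the group law at 0. Extracting the coefficient of the smallest variable u_1
   therefore selects an index j_1, gives the factors of HP or HQ that start at x_(j_1), and cancels
   x_(j_1) from the factors of u_2, ..., u_r; iterating r times produces a sum over ordered choices
   (j_1, ..., j_r), i.e. over S_n / (S_1^r x S_(n-r)).

   Iterated Laurent series are handled as genuine rings LR k. No substitution u := x_j is ever
   performed: "a takes the value b at u = x" is the relation a = b + (u - x) c with c regular in u. *)
Require Import Defs.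
From HB Require Import structures.
From mathcomp Require Import all_boot all_order all_algebra all_fingroup.
From mathcomp Require Import boolp.
From mathcomp Require Import zify ring.
Set Implicit Arguments. Unset Strict Implicit. Unset Printing Implicit Defensive.
Import Order.TTheory GRing.Theory Num.Theory.
Local Open Scope ring_scope.

(** * Laurent series over a commutative ring *)

(** The prefactors in the statement are exactly what the residue at u_1 = x_j consumes. The ratio of
    u_1 and x_j contributes 1/h_j(x_j) = P(x_j), which cancels 1/P(u_1), and leaves x_j +_L [t](bar
    x_j); with x_j^(k-1) from the residue this is [x_j;t]^k, and the factor u/(u +_L [t](bar u))
    turns it into x_j^k. HP and HQ are thus one computation with two prefactors. The cross factor of
    u_1 and u_i becomes the inverse of the ratio of u_i and x_j, whence the cancellation. The
    obstacle is convergence: elements such as x/u must be summed geometrically although they have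
    negative exponents in u. Sums are therefore taken coefficient by coefficient, and the
    infinitesimals of the lexicographic order are shown to have summable powers. Moreover u_1 lies
    in the middle of the tower, since the x are smaller, so its coefficient is taken inside the
    coefficients of the outer variables. Derivatives come from difference quotients, so the
    logarithm may have coefficients in any commutative ring. *)

Definition lbounded (A : nmodType) (f : int -> A) :=
  exists b : int, forall n, n < b -> f n = 0.

Record lau (A : nmodType) := Lau {lcoef :> int -> A; _ : lbounded lcoef}.

Section LauEq.
Variable A : nmodType.

Lemma lauP (f g : lau A) : (forall n, f n = g n) -> f = g.
Proof.
case: f g => [f fP] [g gP] /= /funext fg; rewrite {f}fg in fP *.
by congr Lau; apply: Prop_irrelevance.
Qed.

Lemma lau_bounded (f : lau A) : lbounded f. Proof. by case: f. Qed.

Lemma lbounded0 : lbounded (fun=> 0 : A). Proof. by exists 0. Qed.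

Definition lau0 : lau A := Lau lbounded0.

(* Junk value: the zero series when [f] is not bounded below. *)
Definition mkLau (f : int -> A) : lau A :=
  if pselect (lbounded f) is left fP then Lau fP else lau0.

Lemma mkLauE (f : int -> A) n : lbounded f -> mkLau f n = f n.
Proof. by rewrite /mkLau; case: pselect. Qed.

End LauEq.

HB.instance Definition _ (A : nmodType) := gen_eqMixin (lau A).
HB.instance Definition _ (A : nmodType) := gen_choiceMixin (lau A).

Section LauZmod.
Variable A : zmodType.
Implicit Types f g h : lau A.

Lemma lbounded2 f g :
  exists b, (forall n, n < b -> f n = 0) /\ (forall n, n < b -> g n = 0).
Proof.
have [b fb] := lau_bounded f; have [c gc] := lau_bounded g.
by exists (Num.min b c); split=> n; rewrite lt_min => /andP[nb nc]; auto.
Qed.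

Lemma lau_add_bounded f g : lbounded (fun n => f n + g n).
Proof.
by have [b [fb gb]] := lbounded2 f g; exists b => n nb; rewrite fb ?gb ?addr0.
Qed.
Lemma lau_opp_bounded f : lbounded (fun n => - f n).
Proof. by have [b fb] := lau_bounded f; exists b => n /fb->; rewrite oppr0. Qed.

Definition lau_add f g := Lau (lau_add_bounded f g).
Definition lau_opp f := Lau (lau_opp_bounded f).

Fact lau_addA : associative lau_add.
Proof. by move=> f g h; apply: lauP => n /=; rewrite addrA. Qed.
Fact lau_addC : commutative lau_add.
Proof. by move=> f g; apply: lauP => n /=; rewrite addrC. Qed.
Fact lau_add0 : left_id (lau0 A) lau_add.
Proof. by move=> f; apply: lauP => n /=; rewrite add0r. Qed.
Fact lau_addN : left_inverse (lau0 A) lau_opp lau_add.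
Proof. by move=> f; apply: lauP => n /=; rewrite addNr. Qed.

HB.instance Definition _ :=
  GRing.isZmodule.Build (lau A) lau_addA lau_addC lau_add0 lau_addN.

Lemma lauD f g n : (f + g) n = f n + g n. Proof. by []. Qed.
Lemma lauN f n : (- f) n = - f n. Proof. by []. Qed.
Lemma lau_sum I (r : seq I) (P : pred I) (F : I -> lau A) n :
  (\sum_(i <- r | P i) F i) n = \sum_(i <- r | P i) F i n.
Proof. by elim/big_rec2: _ => // i y1 y2 _ <-. Qed.

End LauZmod.

Section LauRing.
Variable A : comNzRingType.
Implicit Types f g h : lau A.

Definition lconv (b : int) (N : nat) (f g : int -> A) (n : int) : A :=
  \sum_(i < N) f (b + i%:Z) * g (n - b - i%:Z).

(** Lower bounds are only known to exist, so a product computed with one choice must agree with any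
    other. Raising the start drops terms where f vanishes; raising the number of terms adds terms
    where g vanishes. *)
Lemma lconv_indep (b b' c c' : int) (N N' : nat) (f g : int -> A) n :
  (forall n, n < b -> f n = 0) -> (forall n, n < b' -> f n = 0) ->
  (forall n, n < c -> g n = 0) -> (forall n, n < c' -> g n = 0) ->
  n - b - c < N%:Z -> n - b' - c' < N'%:Z ->
  lconv b N f g n = lconv b' N' f g n.
Proof.
wlog le_b : b b' c c' N N' / b <= b'.
  move=> H; case: (leP b b') => [|/ltW] bb' *; first exact: (H b b' c c').
  by symmetry; apply: (H b' b c' c).
move=> fb fb' gc gc' nN nN'.
have widen (d e : int) (M M' : nat) : (M <= M')%N ->
    (forall n, n < e -> g n = 0) -> n - d - e < M%:Z ->
    lconv d M f g n = lconv d M' f g n.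
  move=> leM ge nM; rewrite /lconv (big_ord_widen M' (fun i : nat => f (d + i%:Z) * g (n - d - i%:Z))) //.
  rewrite [RHS](bigID (fun i : 'I_M' => (i < M)%N)) /= [X in _ = _ + X]big1 ?addr0 //.
  by move=> i; rewrite -leqNgt => iM; rewrite (ge (n - d - i%:Z)) ?mulr0 //; lia.
have [k kE] : exists k : nat, b' = b + k%:Z.
  by exists (absz (b' - b)%R); rewrite gez0_abs; lia.
pose M := (N + N')%N.
rewrite (widen b c N (k + M)%N) //; last by rewrite /M; lia.
rewrite (widen b' c' N' M) //; last by rewrite /M; lia.
rewrite /lconv big_split_ord /= big1 ?add0r => [|i _]; last first.
  by rewrite fb' ?mul0r // kE; have := ltn_ord i; lia.
apply: eq_bigr => i _; rewrite kE PoszD.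
by congr (f _ * g _); lia.
Qed.

Lemma lconv_bounded f g :
  lbounded (fun n => lconv (sval (cid (lau_bounded f)))
     (absz (n - sval (cid (lau_bounded f)) - sval (cid (lau_bounded g)))%R).+1 f g n).
Proof.
case: cid => b fb /=; case: cid => c gc /=.
exists (b + c) => n nbc; apply: big1 => i _.
by rewrite (gc (n - b - i%:Z)) ?mulr0 //; lia.
Qed.

Definition lau_mul f g := Lau (lconv_bounded f g).

Arguments lau_mul : simpl never.

Lemma lau_mulE b c N f g n :
  (forall n, n < b -> f n = 0) -> (forall n, n < c -> g n = 0) ->
  n - b - c < N%:Z -> lau_mul f g n = \sum_(i < N) f (b + i%:Z) * g (n - b - i%:Z).
Proof.
move=> fb gc nN; rewrite /lau_mul [LHS]/=.
case: cid => b' fb' /=; case: cid => c' gc' /=.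
by apply: lconv_indep fb' fb gc' gc _ nN; lia.
Qed.

Definition ltrunc (b : int) (N : nat) (f : int -> A) : {poly A} :=
  \poly_(i < N) f (b + i%:Z).

(** A coefficient of a product sees only finite truncations, which become polynomials once shifted
    to start at exponent 0. Commutativity and associativity are inherited from polynomials this
    way. *)
Lemma lau_mul_poly b c N f g (m : nat) :
  (forall n, n < b -> f n = 0) -> (forall n, n < c -> g n = 0) -> (m < N)%N ->
  lau_mul f g (b + c + m%:Z) = (ltrunc b N f * ltrunc c N g)`_m.
Proof.
move=> fb gc mN; rewrite (lau_mulE (N := m.+1) fb gc); last by lia.
rewrite coefM; apply: eq_bigr => i _; have im := ltn_ord i.
rewrite !coef_poly !ifT; try lia.
by congr (_ * g _); lia.
Qed.

Lemma lau_mul_low b c f g n :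
  (forall n, n < b -> f n = 0) -> (forall n, n < c -> g n = 0) -> n < b + c ->
  lau_mul f g n = 0.
Proof.
by move=> fb gc nbc; rewrite (lau_mulE (N := 0) fb gc) ?big_ord0 //; lia.
Qed.


Lemma int_splitP (b n : int) : (n < b) \/ exists m : nat, n = b + m%:Z.
Proof.
case: (ltP n b) => nb; [by left|right].
by exists (absz (n - b)%R); rewrite gez0_abs; lia.
Qed.

Fact lau_mulC : commutative lau_mul.
Proof.
move=> f g; apply: lauP => n.
have [b fb] := lau_bounded f; have [c gc] := lau_bounded g.
have [nbc|[m ->]] := int_splitP (b + c) n.
  by rewrite (lau_mul_low fb gc) // (lau_mul_low gc fb) // addrC.
by rewrite (lau_mul_poly (N := m.+1) fb gc) // mulrC (addrC b) (lau_mul_poly (N := m.+1) gc fb).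
Qed.

Lemma coefM_trunc (p q p' q' : {poly A}) N m : (m < N)%N ->
  (forall i, (i < N)%N -> p`_i = p'`_i) -> (forall i, (i < N)%N -> q`_i = q'`_i) ->
  (p * q)`_m = (p' * q')`_m.
Proof.
move=> mN pp qq; rewrite !coefM; apply: eq_bigr => i _; have im := ltn_ord i.
by rewrite pp ?qq //; lia.
Qed.

Fact lau_mulA : associative lau_mul.
Proof.
move=> f g h; apply: lauP => n.
have [b fb] := lau_bounded f; have [c gc] := lau_bounded g.
have [d hd] := lau_bounded h.
have fg := lau_mul_low fb gc; have gh := lau_mul_low gc hd.
have [nbc|[m ->]] := int_splitP (b + c + d) n.
  by rewrite (lau_mul_low fb gh) ?(lau_mul_low fg hd) //; lia.
rewrite (lau_mul_poly (N := m.+1) fg hd) // -[b + c + d]addrA.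
rewrite (lau_mul_poly (N := m.+1) fb gh) //.
transitivity ((ltrunc b m.+1 f * (ltrunc c m.+1 g * ltrunc d m.+1 h))`_m).
  apply: (@coefM_trunc _ _ _ _ m.+1) => // i im.
  by rewrite coef_poly im (lau_mul_poly gc hd im).
rewrite mulrA; apply: (@coefM_trunc _ _ _ _ m.+1) => // i im.
by rewrite coef_poly im (lau_mul_poly fb gc im).
Qed.

Lemma lmono_bounded (k : int) (a : A) : lbounded (fun n => if n == k then a else 0).
Proof. by exists k => n nk; rewrite ifF //; apply/negbTE; lia. Qed.

Definition lmono (k : int) (a : A) : lau A := Lau (lmono_bounded k a).

Lemma lmonoE k a n : lmono k a n = if n == k then a else 0. Proof. by []. Qed.

Lemma lmono_mulE k a f n : lau_mul (lmono k a) f n = a * f (n - k).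
Proof.
have [c fc] := lau_bounded f.
have kk i : i < k -> lmono k a i = 0 by move=> ik; rewrite lmonoE ifF //; lia.
rewrite (lau_mulE (N := (absz (n - k - c)%R).+1) kk fc); last by lia.
rewrite big_ord_recl lmonoE addr0 eqxx subr0 big1 ?addr0 // => i _.
by rewrite lmonoE ifF ?mul0r //; apply/negbTE; rewrite lift0; lia.
Qed.

Fact lau_mul1 : left_id (lmono 0 1) lau_mul.
Proof. by move=> f; apply: lauP => n; rewrite lmono_mulE mul1r subr0. Qed.

Fact lau_mulDl : left_distributive lau_mul +%R.
Proof.
move=> f g h; apply: lauP => n.
have [b [fb gb]] := lbounded2 f g; have [c hc] := lau_bounded h.
have fgb m : m < b -> (f + g) m = 0 by move=> mb; rewrite lauD fb ?gb ?addr0.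
rewrite lauD !(lau_mulE (b := b) (N := (absz (n - b - c)%R).+1) _ hc) //; try lia.
by rewrite -big_split /=; apply: eq_bigr => i _; rewrite mulrDl.
Qed.

Fact lau_one_neq0 : lmono 0 1 != 0.
Proof.
apply/eqP => /(congr1 (fun f : lau A => f 0)) /= /eqP.
by rewrite oner_eq0.
Qed.

HB.instance Definition _ := GRing.Zmodule_isComNzRing.Build (lau A)
  lau_mulA lau_mulC lau_mul1 lau_mulDl lau_one_neq0.

Lemma lauM b c N f g n :
  (forall n, n < b -> f n = 0) -> (forall n, n < c -> g n = 0) ->
  n - b - c < N%:Z -> (f * g) n = \sum_(i < N) f (b + i%:Z) * g (n - b - i%:Z).
Proof. exact: lau_mulE. Qed.

Lemma lauM_low b c f g n :
  (forall n, n < b -> f n = 0) -> (forall n, n < c -> g n = 0) -> n < b + c ->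
  (f * g) n = 0.
Proof. exact: lau_mul_low. Qed.

Lemma lmonoM k a f n : (lmono k a * f) n = a * f (n - k).
Proof. exact: lmono_mulE. Qed.

Lemma lauE1 : 1 = lmono 0 1 :> lau A. Proof. by []. Qed.

Definition lconst (a : A) : lau A := lmono 0 a.

Lemma lconstE a n : lconst a n = if n == 0 then a else 0. Proof. by []. Qed.

Lemma lconstM a f n : (lconst a * f) n = a * f n.
Proof. by rewrite lmonoM subr0. Qed.

Fact lconst_is_additive : additive lconst.
Proof.
by move=> a b; apply: lauP => n; rewrite lauD lauN !lconstE; case: eqP => // _; rewrite subr0.
Qed.
Fact lconst_is_monoid : monoid_morphism lconst.
Proof.
split=> // a b; apply: lauP => n; rewrite lconstM !lconstE.
by case: eqP => // _; rewrite mulr0.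
Qed.
HB.instance Definition _ := GRing.isZmodMorphism.Build A (lau A) lconst lconst_is_additive.
HB.instance Definition _ := GRing.isMonoidMorphism.Build A (lau A) lconst lconst_is_monoid.

End LauRing.

(** Inverses are chosen classically, so that every level of the tower, including the arbitrary base
    ring, is a [comUnitRingType]. The alias confines this structure to the places where it is
    wanted. *)
Definition classicUnit (A : comNzRingType) : Type := A.
HB.instance Definition _ (A : comNzRingType) := GRing.ComNzRing.copy (classicUnit A) A.

Section ClassicUnit.
Variable A : comNzRingType.
Local Notation B := (classicUnit A).

Definition cunit : pred B := fun x => `[< exists y : B, y * x = 1 >].
Definition cinv (x : B) : B :=
  if pselect (exists y : B, y * x = 1) is left e then sval (cid e) else x.

Fact cmulVr : {in cunit, left_inverse 1 cinv *%R}.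
Proof. by move=> x /asboolP xU; rewrite /cinv; case: pselect => // e; case: cid. Qed.
Fact cunitP (x y : B) : y * x = 1 -> cunit x.
Proof. by move=> yx; apply/asboolP; exists y. Qed.
Fact cinv_out : {in [predC cunit], cinv =1 id}.
Proof.
move=> x; rewrite inE => /negP xU; rewrite /cinv; case: pselect => // e.
by case: xU; apply/asboolP.
Qed.
HB.instance Definition _ := GRing.ComNzRing_hasMulInverse.Build (classicUnit A) cmulVr cunitP cinv_out.
End ClassicUnit.

HB.instance Definition _ (A : comNzRingType) :=
  GRing.ComUnitRing.copy (lau A) (classicUnit (lau A)).

(** * Change of coefficients in Laurent series *)

Section LauMap.
Variables (A B : comNzRingType) (phi : {rmorphism A -> B}).

Lemma lmap_bounded (f : lau A) : lbounded (fun n => phi (f n)).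
Proof. by have [b fb] := lau_bounded f; exists b => n /fb->; rewrite rmorph0. Qed.

Definition lmap (f : lau A) : lau B := Lau (lmap_bounded f).

Fact lmap_is_additive : additive lmap.
Proof. by move=> f g; apply: lauP => n /=; rewrite rmorphB. Qed.
Fact lmap_is_monoid : monoid_morphism lmap.
Proof.
split=> [|f g]; apply: lauP => n.
  change (phi (lmono 0 1 n) = lmono 0 1 n).
  by rewrite !lmonoE; case: eqP => _; rewrite ?rmorph1 ?rmorph0.
have [b fb] := lau_bounded f; have [c gc] := lau_bounded g.
have fb' m : m < b -> lmap f m = 0 by move=> mb /=; rewrite fb ?rmorph0.
have gc' m : m < c -> lmap g m = 0 by move=> mb /=; rewrite gc ?rmorph0.
change (phi ((f * g) n) = (lmap f * lmap g) n).
rewrite (lauM (N := (absz (n - b - c)%R).+1) fb gc) ?(lauM (N := (absz (n - b - c)%R).+1) fb' gc'); try lia.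
by rewrite rmorph_sum; apply: eq_bigr => i _; rewrite rmorphM.
Qed.
HB.instance Definition _ := GRing.isZmodMorphism.Build (lau A) (lau B) lmap lmap_is_additive.
HB.instance Definition _ := GRing.isMonoidMorphism.Build (lau A) (lau B) lmap lmap_is_monoid.
End LauMap.

(** * Iterated Laurent series and pointwise summation *)

Section Iterated.
Variable R : comNzRingType.

Fixpoint LR (k : nat) : comUnitRingType :=
  match k with 0 => classicUnit R | k'.+1 => (lau (LR k') : comUnitRingType) end.

Lemma LRM k b c N (f g : LR k.+1) n :
  (forall n, n < b -> (f : lau (LR k)) n = 0) ->
  (forall n, n < c -> (g : lau (LR k)) n = 0) -> n - b - c < N%:Z ->
  (f * g : lau (LR k)) n =
  \sum_(i < N) (f : lau (LR k)) (b + i%:Z) * (g : lau (LR k)) (n - b - i%:Z).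
Proof. exact: lauM. Qed.

Lemma LRM_low k b c (f g : LR k.+1) n :
  (forall n, n < b -> (f : lau (LR k)) n = 0) ->
  (forall n, n < c -> (g : lau (LR k)) n = 0) -> n < b + c ->
  (f * g : lau (LR k)) n = 0.
Proof. exact: lauM_low. Qed.

Lemma LRM0 k (f g : LR k.+1) :
  (forall n, n < 0 -> (f : lau (LR k)) n = 0) ->
  (forall n, n < 0 -> (g : lau (LR k)) n = 0) ->
  (f * g : lau (LR k)) 0 = (f : lau (LR k)) 0 * (g : lau (LR k)) 0.
Proof. by move=> f0 g0; rewrite (LRM (N := 1) f0 g0) // big_ord1. Qed.

Lemma LRD k (f g : LR k.+1) n :
  (f + g : lau (LR k)) n = (f : lau (LR k)) n + (g : lau (LR k)) n.
Proof. by []. Qed.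

Lemma LRN k (f : LR k.+1) n : (- f : lau (LR k)) n = - (f : lau (LR k)) n.
Proof. by []. Qed.

Lemma LR_lconstM k (a : LR k) (f : LR k.+1) n :
  ((lconst a : LR k.+1) * f : lau (LR k)) n = a * (f : lau (LR k)) n.
Proof. exact: lconstM. Qed.

Lemma LR_lmonoM k i (a : LR k) (f : LR k.+1) n :
  ((lmono i a : LR k.+1) * f : lau (LR k)) n = a * (f : lau (LR k)) (n - i).
Proof. exact: lmonoM. Qed.

Lemma LR_sum k I (r : seq I) (P : pred I) (F : I -> LR k.+1) n :
  (\sum_(i <- r | P i) F i : lau (LR k)) n =
  \sum_(i <- r | P i) (F i : lau (LR k)) n.
Proof. exact: lau_sum. Qed.

Definition finite_sums (A : nmodType) (s : nat -> A) (a : A) :=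
  exists N, (forall j, (N <= j)%N -> s j = 0) /\ a = \sum_(j < N) s j.

(** Convergence coefficient by coefficient: each coefficient in R receives finitely many nonzero
    terms. The lower bound on exponents, uniform in j and required again at every level, is what
    keeps the convolution of two sums finite. *)
Fixpoint sums (k : nat) : (nat -> LR k) -> LR k -> Prop :=
  match k return (nat -> LR k) -> LR k -> Prop with
  | 0 => @finite_sums (LR 0)
  | k'.+1 => fun (s : nat -> lau (LR k')) (a : lau (LR k')) =>
      (exists b : int, forall j n, n < b -> s j n = 0) /\
      forall n, sums (fun j => s j n) (a n)
  end.

Definition summable k (s : nat -> LR k) := exists a, sums s a.

Lemma eq_sums k (s t : nat -> LR k) a : s =1 t -> sums s a -> sums t a.
Proof. by move=> /funext ->. Qed.

Lemma big_ord_vanish (A : nmodType) (s : nat -> A) N M :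
  (forall j, (N <= j)%N -> s j = 0) -> (N <= M)%N ->
  \sum_(j < M) s j = \sum_(j < N) s j.
Proof.
move=> sN NM; rewrite (big_ord_widen M s NM) [LHS](bigID (fun j : 'I_M => (j < N)%N)) /=.
by rewrite [X in _ + X = _]big1 ?addr0 // => j; rewrite -leqNgt => /sN.
Qed.

Lemma sums_uniq k (s : nat -> LR k) a a' : sums s a -> sums s a' -> a = a'.
Proof.
elim: k s a a' => [|k IH] s a a'.
  move=> [N [sN ->]] [M [sM ->]].
  wlog NM : N M sN sM / (N <= M)%N.
    by move=> H; case: (leqP N M) => [|/ltnW] NM; [|symmetry]; exact: H.
  by rewrite (big_ord_vanish sN NM).
by move=> [_ sa] [_ sa']; apply: lauP => n; apply: IH (sa n) (sa' n).
Qed.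

Lemma sums0 k : sums (fun=> 0 : LR k) 0.
Proof.
by elim: k => [|k IH]; [exists 0%N; rewrite big_ord0 | split=> //; exists 0].
Qed.

Lemma sumsD k (s t : nat -> LR k) a b :
  sums s a -> sums t b -> sums (fun j => s j + t j) (a + b).
Proof.
elim: k s t a b => [|k IH] s t a b.
  move=> [N [sN ->]] [M [sM ->]]; exists (N + M)%N; split=> [j jNM|].
    by rewrite sN ?sM ?addr0 //; lia.
  by rewrite big_split /= (big_ord_vanish sN (leq_addr M N)) (big_ord_vanish sM (leq_addl N M)).
move=> [[b1 sb1] sa] [[b2 tb2] tb]; split=> [|n]; last exact: (IH _ _ _ _ (sa n) (tb n)).
exists (Num.min b1 b2) => j n; rewrite lt_min => /andP[n1 n2].
by rewrite LRD sb1 ?tb2 ?addr0.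
Qed.

Lemma sums_big k I (r : seq I) (s : I -> nat -> LR k) (a : I -> LR k) :
  (forall i, sums (s i) (a i)) ->
  sums (fun j => \sum_(i <- r) s i j) (\sum_(i <- r) a i).
Proof.
move=> sa; elim: r => [|i r IH].
  by rewrite big_nil; apply: eq_sums (sums0 k) => j; rewrite big_nil.
rewrite big_cons; apply: eq_sums (sumsD (sa i) IH) => j.
by rewrite big_cons.
Qed.

Definition scons (A : Type) (c : A) (t : nat -> A) (j : nat) : A :=
  if j is j'.+1 then t j' else c.

Lemma sums_scons k (c : LR k) t a : sums t a -> sums (scons c t) (c + a).
Proof.
elim: k c t a => [|k IH] c t a.
  move=> [N [tN ->]]; exists N.+1; split=> [[|j] // jN|]; first exact: tN.
  by rewrite big_ord_recl.
move=> [[b tb] ta]; have [b' cb'] := lau_bounded c; split.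
  exists (Num.min b b') => -[|j] n; rewrite lt_min => /andP[nb nb'] /=.
    exact: cb'.
  exact: tb.
by move=> n; apply: eq_sums (IH (c n) _ _ (ta n)) => -[|j].
Qed.

Lemma sums_behead k (s : nat -> LR k) a : sums s a -> sums (fun j => s j.+1) (a - s 0%N).
Proof.
elim: k s a => [|k IH] s a.
  move=> [N [sN ->]]; exists N; split=> [j jN|]; first by apply: sN; lia.
  by rewrite -(big_ord_vanish sN (leqnSn N)) big_ord_recl addrAC subrr add0r.
move=> [[b sb] sa]; split; first by exists b => j n; apply: sb.
by move=> n; apply: IH (sa n).
Qed.

Lemma sums_single k (c : LR k) : sums (scons c (fun=> 0)) c.
Proof. by rewrite -[c in X in sums _ X]addr0; apply: sums_scons (sums0 k). Qed.

Lemma summable_levels k (s : nat -> lau (LR k)) :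
  (exists b : int, forall j n, n < b -> s j n = 0) ->
  (forall n, summable (fun j => s j n)) -> summable (s : nat -> LR k.+1).
Proof.
move=> [b sb] ss; pose a n := sval (cid (ss n)).
have aP n : sums (fun j => s j n) (a n) by rewrite /a; case: cid.
have ab : lbounded a.
  exists b => n nb; apply: sums_uniq (aP n) _.
  by apply: eq_sums (sums0 k) => j; rewrite sb.
by exists (Lau ab); split; [exists b|].
Qed.

Definition cauchy (A : comNzRingType) (s t : nat -> A) (m : nat) : A :=
  \sum_(j < m.+1) s j * t (m - j)%N.

(** Finite sequences are coefficient lists of polynomials, and a finite sum is the value at 1; the
    Cauchy product is then the product of polynomials. *)
Lemma cauchy_finite (A : comNzRingType) (s t : nat -> A) N M :
  (forall j, (N <= j)%N -> s j = 0) -> (forall j, (M <= j)%N -> t j = 0) ->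
  (forall m, (N + M <= m)%N -> cauchy s t m = 0) /\
  (\sum_(j < N) s j) * (\sum_(j < M) t j) = \sum_(m < N + M) cauchy s t m.
Proof.
move=> sN tM; split=> [m mNM|].
  apply: big1 => j _; have [jN|Nj] := ltnP j N; last by rewrite sN ?mul0r.
  by rewrite tM ?mulr0 //; lia.
pose p := \poly_(j < N) s j; pose q := \poly_(j < M) t j.
have pE j : p`_j = s j by rewrite coef_poly; case: ltnP => // /sN->.
have qE j : q`_j = t j by rewrite coef_poly; case: ltnP => // /tM->.
have horner1 (p0 : {poly A}) d : (size p0 <= d)%N -> \sum_(j < d) p0`_j = p0.[1].
  by move=> /horner_coef_wide ->; apply: eq_bigr => j _; rewrite expr1n mulr1.
transitivity (p.[1] * q.[1]).
  rewrite -(horner1 p N) ?size_poly // -(horner1 q M) ?size_poly //.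
  by congr (_ * _); apply: eq_bigr => j _; rewrite ?pE ?qE.
rewrite -hornerM -(horner1 (p * q) (N + M)%N).
  apply: eq_bigr => m _; rewrite coefM; apply: eq_bigr => j _.
  by rewrite pE qE.
apply: leq_trans (size_polyMleq _ _) (leq_trans (leq_pred _) _).
by rewrite leq_add ?size_poly.
Qed.

(** By the uniform bounds, one number N of terms serves the convolution of s_i and t_j for all i and
    j at once. A coefficient of the product is then a finite sum of Cauchy products at the level
    below. *)
Lemma sums_cauchy k (s t : nat -> LR k) a b :
  sums s a -> sums t b -> sums (cauchy s t) (a * b).
Proof.
elim: k s t a b => [|k IH] s t a b.
  move=> [N [sN ->]] [M [tM ->]]; exists (N + M)%N.
  exact: cauchy_finite.
move=> [[b1 sb1] sa] [[b2 tb2] tb].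
have ab1 n : n < b1 -> (a : lau _) n = 0.
  by move=> nb; apply: sums_uniq (sa n) _; apply: eq_sums (sums0 k) => j; rewrite sb1.
have bb2 n : n < b2 -> (b : lau _) n = 0.
  by move=> nb; apply: sums_uniq (tb n) _; apply: eq_sums (sums0 k) => j; rewrite tb2.
split.
  exists (b1 + b2) => m n nb; rewrite LR_sum; apply: big1 => j _.
  by apply: (LRM_low (sb1 j) (tb2 _)).
move=> n; pose N := (absz (n - b1 - b2)%R).+1.
have nN : n - b1 - b2 < N%:Z by rewrite /N; lia.
change (sums (fun m => (cauchy s t m : lau (LR k)) n) ((a * b : lau (LR k)) n)).
rewrite (LRM ab1 bb2 nN).
apply: eq_sums (sums_big (index_enum 'I_N) (fun i : 'I_N =>
   IH _ _ _ _ (sa (b1 + i%:Z)) (tb (n - b1 - i%:Z)))) => m.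
rewrite LR_sum exchange_big /=; apply: eq_bigr => j _.
symmetry; exact: (LRM (sb1 j) (tb2 (m - j)%N) nN).
Qed.

Lemma sumsMl k c (s : nat -> LR k) a : sums s a -> sums (fun j => c * s j) (c * a).
Proof.
move=> sa; apply: eq_sums (sums_cauchy (sums_single c) sa) => j.
by rewrite /cauchy big_ord_recl subn0 big1 ?addr0 // => i _; rewrite mul0r.
Qed.

Lemma sumsN k (s : nat -> LR k) a : sums s a -> sums (fun j => - s j) (- a).
Proof. by move=> /(sumsMl (-1)); rewrite mulN1r; apply: eq_sums => j; rewrite mulN1r. Qed.

Lemma sumsB k (s t : nat -> LR k) a b :
  sums s a -> sums t b -> sums (fun j => s j - t j) (a - b).
Proof. by move=> sa /sumsN; apply: sumsD. Qed.

Fixpoint cst (k : nat) : R -> LR k :=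
  match k return R -> LR k with 0 => id | k'.+1 => fun a => lconst (cst k' a) end.

Fact cst_is_additive k : additive (@cst k).
Proof. by elim: k => [//|k IH] a b /=; rewrite IH rmorphB. Qed.
Fact cst_is_monoid k : monoid_morphism (@cst k).
Proof.
elim: k => [//|k [IH1 IHM]]; split=> [|a b] /=; first by rewrite IH1 rmorph1.
by rewrite IHM rmorphM.
Qed.
HB.instance Definition _ k := GRing.isZmodMorphism.Build R (LR k) (@cst k) (@cst_is_additive k).
HB.instance Definition _ k := GRing.isMonoidMorphism.Build R (LR k) (@cst k) (@cst_is_monoid k).

Lemma summable_scale k (c : nat -> R) (s : nat -> LR k) :
  summable s -> summable (fun j => cst k (c j) * s j).
Proof.
elim: k s => [|k IH] s [a].
  move=> [N [sN _]]; exists (\sum_(j < N) cst 0 (c j) * s j); exists N; split=> // j /sN ->.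
  by rewrite mulr0.
move=> [[b sb] sa]; apply: summable_levels => [|n].
  by exists b => j n nb; rewrite LR_lconstM sb ?mulr0.
have [a' sa'] := IH (fun j => (s j : lau _) n) (ex_intro _ _ (sa n)).
by exists a'; apply: eq_sums sa' => j; rewrite LR_lconstM.
Qed.

(* The maximal ideal and the ring of the lexicographic valuation: the smallest
   variable is compared first. *)
Fixpoint small (k : nat) : LR k -> Prop :=
  match k return LR k -> Prop with
  | 0 => fun g => g = 0
  | k'.+1 => fun g : lau (LR k') => (forall n, n < 0 -> g n = 0) /\ small (g 0)
  end.

Fixpoint valint (k : nat) : LR k -> Prop :=
  match k return LR k -> Prop with
  | 0 => fun g => True
  | k'.+1 => fun g : lau (LR k') => (forall n, n < 0 -> g n = 0) /\ valint (g 0)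
  end.

Lemma small_valint k (g : LR k) : small g -> valint g.
Proof. by elim: k g => [//|k IH] g [g0 /IH]. Qed.

Lemma small0 k : small (0 : LR k).
Proof. by elim: k => [|k IH]. Qed.

Lemma smallD k (f g : LR k) : small f -> small g -> small (f + g).
Proof.
elim: k f g => [|k IH] f g; first by move=> -> ->; rewrite /= addr0.
move=> [f0 fs] [g0 gs]; split=> [n n0|]; last exact: IH.
by rewrite LRD f0 ?g0 ?addr0.
Qed.

Lemma valintD k (f g : LR k) : valint f -> valint g -> valint (f + g).
Proof.
elim: k f g => [|k IH] f g //.
move=> [f0 fs] [g0 gs]; split=> [n n0|]; last exact: IH.
by rewrite LRD f0 ?g0 ?addr0.
Qed.

Lemma smallMl k (f g : LR k) : valint f -> small g -> small (f * g).
Proof.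
elim: k f g => [|k IH] f g; first by move=> _ ->; rewrite /= mulr0.
move=> [f0 fs] [g0 gs]; split=> [n n0|]; first exact: (LRM_low f0 g0).
by rewrite (LRM0 f0 g0); apply: IH.
Qed.

Lemma smallMr k (f g : LR k) : small f -> valint g -> small (f * g).
Proof. by move=> fs gv; rewrite mulrC; apply: smallMl. Qed.

Lemma valintM k (f g : LR k) : valint f -> valint g -> valint (f * g).
Proof.
elim: k f g => [|k IH] f g //.
move=> [f0 fs] [g0 gs]; split=> [n n0|]; first exact: (LRM_low f0 g0).
by rewrite (LRM0 f0 g0); apply: IH.
Qed.

Lemma valint_cst k a : valint (cst k a).
Proof.
elim: k => [//|k IH]; split=> [n n0|]; last exact: IH.
by rewrite /= ifF //; apply/negbTE; lia.
Qed.

Lemma valint1 k : valint (1 : LR k).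
Proof. by rewrite -(rmorph1 (@cst k)); apply: valint_cst. Qed.

Lemma smallN k (f : LR k) : small f -> small (- f).
Proof. by move=> fs; rewrite -mulN1r -(rmorph1 (@cst k)) -rmorphN; apply: smallMl => //; apply: valint_cst. Qed.

Lemma smallB k (f g : LR k) : small f -> small g -> small (f - g).
Proof. by move=> fs /smallN; apply: smallD. Qed.

Lemma small_sums k (s : nat -> LR k) a : sums s a -> (forall j, small (s j)) -> small a.
Proof.
elim: k s a => [|k IH] s a.
  by move=> [N [_ ->]] ss; apply: big1 => j _; exact: ss.
move=> [_ sa] ss; split=> [n n0|].
  apply: sums_uniq (sa n) _; apply: eq_sums (sums0 k) => j.
  by have [sj _] := ss j; rewrite (sj n n0).
by apply: IH (sa 0) _ => j; case: (ss j).
Qed.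

Lemma valint_sums k (s : nat -> LR k) a : sums s a -> (forall j, valint (s j)) -> valint a.
Proof.
elim: k s a => [//|k IH] s a [_ sa] ss; split=> [n n0|].
  apply: sums_uniq (sa n) _; apply: eq_sums (sums0 k) => j.
  by have [sj _] := ss j; rewrite (sj n n0).
by apply: IH (sa 0) _ => j; case: (ss j).
Qed.

(** Solves a first-order linear recurrence as the convolution of a geometric sequence with the
    inhomogeneous term, a form to which [sums_cauchy] applies. *)
Lemma cauchy_rec (A : comNzRingType) (g c : A) (a b : nat -> A) :
  a 0%N = c -> (forall j, a j.+1 = g * a j + b j) ->
  a =1 cauchy (fun j => g ^+ j) (scons c b).
Proof.
move=> a0 aS; elim=> [|j IH]; first by rewrite /cauchy big_ord1 expr0 mul1r a0.
rewrite aS IH /cauchy mulr_sumr [RHS]big_ord_recl /= expr0 mul1r addrC; congr (_ + _).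
by apply: eq_bigr => i _; rewrite mulrA -exprS.
Qed.

End Iterated.

(** * Power series evaluated at infinitesimal elements *)

Section Series.
Variable R : comNzRingType.
Local Notation LR := (LR R).

Lemma sums_const k (s : nat -> LR k) a :
  sums s a -> sums (fun j => lconst (s j) : LR k.+1) (lconst a : LR k.+1).
Proof.
move=> sa; split=> [|n]; first by exists 0 => j n n0; rewrite lconstE ifF //; apply/negbTE; lia.
rewrite lconstE; under eq_fun do rewrite lconstE.
by case: eqP => _ //; apply: sums0.
Qed.

Lemma expr_low k (g : LR k.+1) j n : (forall n, n < 0 -> (g : lau (LR k)) n = 0) ->
  n < 0 -> (g ^+ j : lau (LR k)) n = 0.
Proof.
move=> g0; elim: j n => [|j IH] n n0.
  by rewrite expr0; change ((if n == 0 then 1 else 0) = 0 :> LR k); rewrite ifF //; apply/negbTE; lia.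
by rewrite exprS; apply: (LRM_low g0 (b := 0) (c := 0)).
Qed.

(** Double induction, on the level and on the exponent p of the last variable. The coefficient of
    exponent p in g^(j+1) is g_0 times that in g^j, plus a combination of coefficients of g^j of
    exponent below p. Hence it is a convolution of the powers of g_0, summable at the level below,
    with a sequence already known to be summable. *)
Lemma summable_expr k (g : LR k) : small g -> summable (fun j => g ^+ j).
Proof.
elim: k g => [|k IH] g.
  move=> ->; exists 1; exists 1%N; split=> [[|j] //|]; first by rewrite exprS mul0r.
  by rewrite big_ord1 expr0.
move=> [g0 gs]; have powlow j n := @expr_low k g j n g0.
apply: summable_levels => [|n]; first by exists 0 => j n; apply: powlow.
have [n0|[p ->]] := int_splitP 0 n.
  by exists 0; apply: eq_sums (sums0 _ k) => j; rewrite powlow.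
rewrite add0r; have [p' pp'] := ubnP p; elim: p' p pp' => // p' IHp p pp'.
pose b j := \sum_(i < p) (g : lau (LR k)) i.+1%:Z * (g ^+ j : lau (LR k)) (p - i.+1)%N%:Z.
have step j : (g ^+ j.+1 : lau (LR k)) p%:Z =
    (g : lau (LR k)) 0 * (g ^+ j : lau (LR k)) p%:Z + b j.
  rewrite exprS (LRM (N := p.+1) g0 (powlow j)); last by lia.
  rewrite big_ord_recl addr0 !subr0; congr (_ + _); apply: eq_bigr => i _.
  by congr (_ * (_ : lau _) _); rewrite lift0; have := ltn_ord i; lia.
have [Gsum GP] := IH _ gs.
have [B BP] : summable b.
  have S (i : 'I_p) : summable (fun j => (g ^+ j : lau (LR k)) (p - i.+1)%N%:Z).
    by apply: IHp; have := ltn_ord i; lia.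
  exists (\sum_(i < p) (g : lau (LR k)) i.+1%:Z * sval (cid (S i))).
  by apply: sums_big => i; apply: sumsMl; case: (cid (S i)).
eexists; apply: eq_sums (sums_cauchy GP (sums_scons ((1 : lau (LR k)) p%:Z) BP)) => j.
exact/esym/(@cauchy_rec _ _ _ (fun j => (g ^+ j : lau (LR k)) p%:Z) _ (erefl _) step).
Qed.

Definition lsum k (s : nat -> LR k) : LR k :=
  if pselect (summable s) is left e then sval (cid e) else 0.

Lemma lsumP k (s : nat -> LR k) : summable s -> sums s (lsum s).
Proof. by rewrite /lsum; case: pselect => // e _; case: cid. Qed.

Lemma lsumE k (s : nat -> LR k) a : sums s a -> lsum s = a.
Proof. by move=> sa; apply: (sums_uniq _ sa); apply: lsumP; exists a. Qed.

Definition ser k (c : nat -> R) (g : LR k) : LR k := lsum (fun j => cst k (c j) * g ^+ j).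

Lemma serP k c (g : LR k) : small g -> sums (fun j => cst k (c j) * g ^+ j) (ser c g).
Proof. by move=> gs; apply/lsumP/summable_scale/summable_expr. Qed.

Lemma ser_ext k c d (g : LR k) : c =1 d -> ser c g = ser d g.
Proof. by move=> /funext->. Qed.

Lemma ser_cauchy k c d (g : LR k) : small g -> ser (cauchy c d) g = ser c g * ser d g.
Proof.
move=> gs; apply: lsumE; apply: eq_sums (sums_cauchy (serP c gs) (serP d gs)) => j.
rewrite /cauchy rmorph_sum mulr_suml; apply: eq_bigr => i _; rewrite rmorphM.
by rewrite mulrACA -exprD subnKC // -ltnS.
Qed.

Definition one_seq : nat -> R := scons 1 (fun=> 0).
Definition X_seq : nat -> R := scons 0 (scons 1 (fun=> 0)).

Lemma ser_one k (g : LR k) : ser one_seq g = 1.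
Proof.
apply: lsumE; apply: eq_sums (sums_single 1) => -[|j] /=; rewrite ?rmorph1 ?mul1r //.
by rewrite rmorph0 mul0r.
Qed.

Lemma ser_X k (g : LR k) : ser X_seq g = g.
Proof.
apply: lsumE; rewrite -[g in sums _ g]add0r.
apply: eq_sums (sums_scons 0 (sums_single g)) => -[|[|j]] /=.
- by rewrite rmorph0 mul0r.
- by rewrite rmorph1 mul1r.
- by rewrite rmorph0 mul0r.
Qed.

Fixpoint seq_pow (d : nat -> R) (j : nat) : nat -> R :=
  if j is j'.+1 then cauchy d (seq_pow d j') else one_seq.

Lemma ser_pow k d (g : LR k) j : small g -> ser (seq_pow d j) g = ser d g ^+ j.
Proof.
by move=> gs; elim: j => [|j IH] /=; rewrite ?ser_one // ser_cauchy // IH exprS.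
Qed.

Lemma seq_pow_low d j i : d 0%N = 0 -> (i < j)%N -> seq_pow d j i = 0.
Proof.
move=> d0; elim: j i => // j IH i ij /=; apply: big1 => -[[|p] pi] _ /=.
  by rewrite d0 mul0r.
by rewrite IH ?mulr0 //; lia.
Qed.

Lemma seq_pow_diag d j : d 0%N = 0 -> d 1%N = 1 -> seq_pow d j j = 1.
Proof.
move=> d0 d1; elim: j => // j IH /=; rewrite /cauchy big_ord_recl d0 mul0r add0r.
rewrite big_ord_recl /= d1 mul1r subSS subn0 IH big1 ?addr0 // => i _.
by rewrite seq_pow_low ?mulr0 //=; have := ltn_ord i; rewrite /bump /=; lia.
Qed.

Definition seq_comp (c d : nat -> R) (i : nat) : R :=
  \sum_(j < i.+1) c j * seq_pow d j i.

(** The exchange of summations behind composition of series. The coefficients c j i are scalars, so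
    the exchange can be made at each exponent separately, down to the base ring, where G has
    finitely many nonzero terms; triangularity makes the sum over j finite for each i. *)
Lemma sums_triangular k (G : nat -> LR k) (c : nat -> nat -> R) :
  summable G -> (forall j i, (i < j)%N -> c j i = 0) ->
  sums (fun j => lsum (fun i => cst k (c j i) * G i))
       (lsum (fun i => cst k (\sum_(j < i.+1) c j i) * G i)).
Proof.
move=> Gs c0.
(* The sums are carried as witnesses instead of values of [lsum], so that the induction hypothesis
   can be used at every exponent and its witnesses compared by uniqueness. *)
suff [r [A [rP AP rA]]] : exists r A, [/\ forall j, sums (fun i => cst k (c j i) * G i) (r j),
    sums (fun i => cst k (\sum_(j < i.+1) c j i) * G i) A & sums r A].
  by rewrite (lsumE AP); apply: eq_sums rA => j; rewrite (lsumE (rP j)).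
elim: k G Gs => [|k IH] G Gs.
  have [a [N [GN _]]] := Gs.
  exists (fun j => \sum_(i < N) cst 0 (c j i) * G i).
  exists (\sum_(i < N) cst 0 (\sum_(j < i.+1) c j i) * G i); split.
  - by move=> j; exists N; split=> // i /GN ->; rewrite mulr0.
  - by exists N; split=> // i /GN ->; rewrite mulr0.
  exists N; split=> [j Nj|].
    by apply: big1 => i _; rewrite c0 ?rmorph0 ?mul0r //; have := ltn_ord i; lia.
  rewrite exchange_big; apply: eq_bigr => i _; rewrite rmorph_sum mulr_suml.
  rewrite (big_ord_widen N (fun j => cst 0 (c j i) * G i)) //.
  rewrite [RHS](bigID (fun j : 'I_N => (j < i.+1)%N)) /= [X in _ = _ + X]big1 ?addr0 // => j.
  by rewrite -leqNgt => ij; rewrite c0 ?rmorph0 ?mul0r.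
have [a [[b Gb] Ga]] := Gs.
have lev n : summable (fun i => (G i : lau (LR k)) n) 
  by exists ((a : lau (LR k)) n); exact: (Ga n).
have /choice [rA rAP] := fun n => IH _ (lev n).
have/choice [r rP] : forall j, exists r, sums (fun i => cst k.+1 (c j i) * G i) r.
  by move=> j; apply: summable_scale.
have [A AP] : summable (fun i => cst k.+1 (\sum_(j < i.+1) c j i) * G i).
  exact: (summable_scale (fun i => \sum_(j < i.+1) c j i)).
exists r, A; split=> //; split.
  exists b => j n nb; have [_ /(_ n) rn] := rP j; apply: sums_uniq rn _.
  by apply: eq_sums (sums0 _ k) => i; rewrite LR_lconstM Gb ?mulr0.
move=> n; have [A' [r'P A'P r'A']] := rAP n.
have -> : (A : lau (LR k)) n = A'.
  have [_ /(_ n) An] := AP; apply: sums_uniq An _; apply: eq_sums A'P => i.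
  by rewrite LR_lconstM.
apply: eq_sums r'A' => j; have [_ /(_ n) rn] := rP j.
apply: sums_uniq (r'P j) _; apply: eq_sums rn => i; by rewrite LR_lconstM.
Qed.

Lemma ser_comp k c d (g : LR k) : small g -> d 0%N = 0 ->
  sums (fun j => cst k (c j) * ser d g ^+ j) (ser (seq_comp c d) g).
Proof.
move=> gs d0; apply: eq_sums (@sums_triangular _ _ (fun j i => c j * seq_pow d j i)
  (summable_expr gs) _) => [j|j i ij]; last by rewrite seq_pow_low ?mulr0.
rewrite -ser_pow //; apply: lsumE; apply: eq_sums (sumsMl _ (serP _ gs)) => i.
by rewrite rmorphM mulrA.
Qed.

Lemma small_expr k (g : LR k) j : small g -> small (g ^+ j.+1).
Proof.
move=> gs; elim: j => [|j IH]; first by rewrite expr1.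
by rewrite exprS; apply: smallMr => //; apply: small_valint.
Qed.

Lemma valint_expr k (g : LR k) j : valint g -> valint (g ^+ j).
Proof.
by move=> gs; elim: j => [|j IH]; [exact: valint1 | rewrite exprS; apply: valintM].
Qed.

Lemma small_ser k c (g : LR k) : small g -> c 0%N = 0 -> small (ser c g).
Proof.
move=> gs c0; apply: small_sums (serP c gs) _ => -[|j].
  by rewrite c0 rmorph0 mul0r; apply: small0.
by apply: smallMl; [apply: valint_cst | apply: small_expr].
Qed.

Lemma ser_ser k c d (g : LR k) : small g -> d 0%N = 0 ->
  ser c (ser d g) = ser (seq_comp c d) g.
Proof. by move=> gs d0; apply: lsumE; apply: ser_comp. Qed.

(** Triangular solution of f(d(x)) = x. Since d^n has leading coefficient 1 in degree n, the n-th
    coefficient of f is determined by the preceding ones without division. *)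
Fixpoint comp_inv_prefix (d : nat -> R) (n : nat) : seq R :=
  if n is n'.+1 then
    let s := comp_inv_prefix d n' in
    rcons s (X_seq n' - \sum_(j < n') s`_j * seq_pow d j n')
  else [::].

Lemma comp_inv_exists d : d 0%N = 0 -> d 1%N = 1 ->
  exists f, f 0%N = 0 /\ seq_comp f d =1 X_seq.
Proof.
move=> d0 d1; pose f n := (comp_inv_prefix d n.+1)`_n.
have size_pre n : size (comp_inv_prefix d n) = n.
  by elim: n => //= n IH; rewrite size_rcons IH.
have preE n j : (j < n)%N -> (comp_inv_prefix d n)`_j = f j.
  elim: n => // n IH; rewrite ltnS leq_eqVlt => /orP[/eqP->//|jn].
  by rewrite /= nth_rcons size_pre jn IH.
exists f; split=> [|n].
  by rewrite /f /= big_ord0 subr0.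
rewrite /seq_comp big_ord_recr /= seq_pow_diag // mulr1 /f /= nth_rcons size_pre ltnn eqxx.
rewrite addrC -addrA [X in _ + X](_ : _ = 0) ?addr0 //; apply/eqP.
rewrite addrC subr_eq0; apply/eqP; apply: eq_bigr => j _.
by rewrite preE.
Qed.

End Series.

(** * Difference quotients, units and the insertion of a variable *)

Section Taylor.
Variable R : comNzRingType.
Local Notation LR := (LR R).

(** Values of series, difference quotients and inverses of 1 + small inherit every property stable
    under these operations. One set of lemmas thus serves both [valint] and regularity in the
    variable u. *)
Record closed_subring k (P : LR k -> Prop) : Prop := ClosedSubring {
  csub_cst : forall a, P (cst k a);
  csubD : forall f g, P f -> P g -> P (f + g);
  csubM : forall f g, P f -> P g -> P (f * g);
  csub_sums : forall s a, sums s a -> (forall j, P (s j)) -> P a }.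

Section Closed.
Variables (k : nat) (P : LR k -> Prop).
Hypothesis cP : closed_subring P.

Lemma csub1 : P 1. Proof. by rewrite -(rmorph1 (@cst R k)); apply: csub_cst. Qed.
Lemma csub0 : P 0. Proof. by rewrite -(rmorph0 (@cst R k)); apply: csub_cst. Qed.
Lemma csubN f : P f -> P (- f).
Proof.
move=> Pf; rewrite -mulN1r -(rmorph1 (@cst R k)) -rmorphN; apply: csubM => //.
exact: csub_cst.
Qed.
Lemma csubB f g : P f -> P g -> P (f - g).
Proof. by move=> Pf Pg; apply: csubD => //; apply: csubN. Qed.
Lemma csubX f j : P f -> P (f ^+ j).
Proof.
by move=> Pf; elim: j => [|j IH]; [exact: csub1 | rewrite exprS; apply: csubM].
Qed.
Lemma csub_big_sum I (r : seq I) (Q : pred I) (F : I -> LR k) :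
  (forall i, Q i -> P (F i)) -> P (\sum_(i <- r | Q i) F i).
Proof. by move=> PF; apply: big_ind => //; [exact: csub0 | exact: csubD]. Qed.
Lemma csub_big_prod (I : eqType) (r : seq I) (Q : pred I) (F : I -> LR k) :
  (forall i, i \in r -> Q i -> P (F i)) -> P (\prod_(i <- r | Q i) F i).
Proof.
move=> PF; rewrite big_seq_cond; apply: big_ind => //; [exact: csub1 | exact: csubM |].
by move=> i /andP[]; apply: PF.
Qed.
Lemma csub_ser c f : small f -> P f -> P (ser c f).
Proof.
move=> fs Pf; apply: (csub_sums cP (serP c fs)) => j.
by apply: (csubM cP); [exact: (csub_cst cP) | exact: csubX].
Qed.
Lemma csub_cauchy s t j : (forall i, P (s i)) -> (forall i, P (t i)) -> P (cauchy s t j).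
Proof. by move=> Ps Pt; apply: csub_big_sum => i _; apply: csubM. Qed.
End Closed.

Lemma closed_valint k : closed_subring (@valint R k).
Proof.
split; [exact: valint_cst | exact: valintD | exact: valintM | exact: valint_sums].
Qed.

Section DifferenceQuotient.
Variables (k : nat) (a b : LR k).
Hypotheses (as_ : small a) (bs : small b).

(** The quotient (a^j - b^j)/(a - b) as an explicit sum of monomials, so that a - b need not be
    invertible. *)
Definition dquot_expr : nat -> LR k :=
  scons 0 (cauchy (fun j => a ^+ j) (fun j => b ^+ j)).
(** The second-order quotient ((a^j - b^j)/(a - b) - j b^(j-1))/(a - b), again free of division. *)
Definition dquot_expr2 : nat -> LR k :=
  scons 0 (cauchy (fun j => b ^+ j) dquot_expr).

Lemma summable_scons (A : LR k) t : summable t -> summable (scons A t).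
Proof. by case=> s /(sums_scons A) ts; exists (A + s). Qed.
Lemma summable_cauchy (s t : nat -> LR k) : summable s -> summable t -> summable (cauchy s t).
Proof. by move=> [x sx] [y ty]; exists (x * y); apply: sums_cauchy. Qed.

Lemma summable_dquot : summable dquot_expr.
Proof. by apply: summable_scons; apply: summable_cauchy; apply: summable_expr. Qed.
Lemma summable_dquot2 : summable dquot_expr2.
Proof.
apply: summable_scons; apply: summable_cauchy; last exact: summable_dquot.
exact: summable_expr.
Qed.

Lemma dquot_exprE j : a ^+ j - b ^+ j = (a - b) * dquot_expr j.
Proof.
case: j => [|j]; first by rewrite !expr0 subrr mulr0.
rewrite subrXX /dquot_expr /= /cauchy; congr (_ * _).
rewrite (reindex_inj rev_ord_inj) /=; apply: eq_bigr => i _; rewrite subKn //.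
by rewrite -ltnS.
Qed.

Lemma dquot_expr2E j : dquot_expr j - (b ^+ j.-1) *+ j = (a - b) * dquot_expr2 j.
Proof.
case: j => [|j]; first by rewrite mulr0n subr0 mulr0.
rewrite /dquot_expr2 /= /cauchy mulr_sumr.
have -> : b ^+ j *+ j.+1 = \sum_(i < j.+1) b ^+ i * b ^+ (j - i).
  rewrite (eq_bigr (fun=> b ^+ j)) => [|i _]; last by rewrite -exprD subnKC // -ltnS.
  by rewrite sumr_const card_ord.
rewrite {1}/dquot_expr /= /cauchy (reindex_inj rev_ord_inj) /= -sumrB.
apply: eq_bigr => i _; have ij : (i <= j)%N by rewrite -ltnS.
by rewrite !subSS (subKn ij) mulrCA -dquot_exprE mulrBr [a ^+ _ * _]mulrC.
Qed.

Definition dquot (c : nat -> R) := lsum (fun j => cst k (c j) * dquot_expr j).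
Definition dquot2 (c : nat -> R) := lsum (fun j => cst k (c j) * dquot_expr2 j).

Lemma dquotP c : sums (fun j => cst k (c j) * dquot_expr j) (dquot c).
Proof. exact/lsumP/summable_scale/summable_dquot. Qed.
Lemma dquot2P c : sums (fun j => cst k (c j) * dquot_expr2 j) (dquot2 c).
Proof. exact/lsumP/summable_scale/summable_dquot2. Qed.

Lemma ser_dquot c : ser c a - ser c b = (a - b) * dquot c.
Proof.
apply: sums_uniq (sumsB (serP c as_) (serP c bs)) _.
apply: eq_sums (sumsMl (a - b) (dquotP c)) => j.
by rewrite mulrCA -dquot_exprE mulrBr.
Qed.

Definition seq_deriv (c : nat -> R) (j : nat) : R := c j.+1 *+ j.+1.

Lemma dquot_dquot2 c : dquot c - ser (seq_deriv c) b = (a - b) * dquot2 c.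
Proof.
have dP := sums_scons 0 (serP (seq_deriv c) bs); rewrite add0r in dP.
apply: sums_uniq (sumsB (dquotP c) dP) _.
apply: eq_sums (sumsMl (a - b) (dquot2P c)) => j.
rewrite mulrCA -dquot_expr2E mulrBr; congr (_ - _); case: j => [|j] /=.
  by rewrite mulr0n mulr0.
by rewrite /seq_deriv rmorphMn mulrnAl mulrnAr.
Qed.

Lemma csub_dquot_expr P j : closed_subring P -> P a -> P b -> P (dquot_expr j).
Proof.
move=> cP Pa Pb; case: j => [|j]; first exact: csub0.
by apply: csub_cauchy => // i; apply: csubX.
Qed.

Lemma csub_dquot P c : closed_subring P -> P a -> P b -> P (dquot c).
Proof.
move=> cP Pa Pb; apply: (csub_sums cP (dquotP c)) => j.
by apply: csubM => //; [exact: csub_cst | exact: csub_dquot_expr].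
Qed.

Lemma csub_dquot2 P c : closed_subring P -> P a -> P b -> P (dquot2 c).
Proof.
move=> cP Pa Pb; apply: (csub_sums cP (dquot2P c)) => j.
apply: csubM => //; first exact: csub_cst.
case: j => [|j]; first exact: csub0.
by apply: csub_cauchy => // i; [exact: csubX | exact: csub_dquot_expr].
Qed.

(** The term j = 0 vanishes and the term j = 1 is c_1; every monomial of a later term contains a
    factor a or b. *)
Lemma dquot_small c : small (dquot c - cst k (c 1%N)).
Proof.
have /sums_behead/sums_behead := dquotP c.
rewrite {2 3}/dquot_expr /= /cauchy big_ord1 !expr0 mulr0 subr0 !mulr1.
move=> /small_sums; apply=> j; apply: smallMl; first exact: valint_cst.
rewrite /dquot_expr /= /cauchy; elim/big_ind: _ => [||i _].
- exact: small0.
- exact: smallD.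
case: i => [[|i] ij] /=.
  by rewrite expr0 mul1r; apply: small_expr.
apply: smallMr; first exact: small_expr.
by apply: valint_expr; apply: small_valint.
Qed.
End DifferenceQuotient.

Lemma ser0 k c : ser c (0 : LR k) = cst k (c 0%N).
Proof.
apply: lsumE; apply: eq_sums (sums_single _) => -[|j] /=; first by rewrite expr0 mulr1.
by rewrite exprS mul0r mulr0.
Qed.

Lemma ser_factor k c (a : LR k) (P : LR k -> Prop) : small a -> c 0%N = 0 ->
  closed_subring P -> P a ->
  exists q, [/\ ser c a = a * q, P q & small (q - cst k (c 1%N))].
Proof.
move=> as_ c0 cP Pa; exists (dquot a 0 c); split.
- by have := ser_dquot as_ (small0 _ k) c; rewrite ser0 c0 rmorph0 !subr0.
- by apply: csub_dquot => //; [exact: small0 | exact: csub0].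
- by apply: dquot_small => //; exact: small0.
Qed.

Lemma geometric_sum k (b g : LR k) : sums (fun j => b ^+ j) g -> (1 - b) * g = 1.
Proof.
move=> gP; have /sums_behead := gP; rewrite expr0 => g1.
have g2 : sums (fun j => b ^+ j.+1) (b * g).
  by apply: eq_sums (sumsMl b gP) => j; rewrite exprS.
by rewrite mulrBl mul1r -(sums_uniq g1 g2) opprB addrC subrK.
Qed.

Lemma one_sub_small_inv k (b : LR k) (P : LR k -> Prop) : small b ->
  closed_subring P -> P b -> exists g, (1 - b) * g = 1 /\ P g.
Proof.
move=> bs cP Pb; have [g gP] := summable_expr bs; exists g; split.
  exact: geometric_sum.
by apply: (csub_sums cP gP) => j; apply: csubX.
Qed.

Lemma inv_eq (A : comUnitRingType) (x y : A) : x * y = 1 -> x \is a GRing.unit /\ x^-1 = y.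
Proof.
move=> xy; have xU : x \is a GRing.unit by apply/unitrPr; exists y.
by split=> //; rewrite -[x^-1]mulr1 -xy mulKr.
Qed.

(** Invertibility inside P is stronger than invertibility in the ring: the variable u is a unit, but
    its inverse is not regular in u. Taking the value of an inverse at a point requires the strong
    form. *)
Definition cunit_in k (P : LR k -> Prop) (a : LR k) :=
  [/\ a \is a GRing.unit, P a & P a^-1].

Lemma cunit_in_small k (h : LR k) P : closed_subring P -> small (h - 1) -> P h -> cunit_in P h.
Proof.
move=> cP hs Ph; have := @one_sub_small_inv k (1 - h) P.
have hE : 1 - (1 - h) = h by rewrite opprB addrC subrK.
rewrite hE -{1}opprB => /(_ (smallN hs) cP) [|g [hg Pg]].
  by apply: csubB => //; exact: csub1.
by have [hU hV] := inv_eq hg; split; rewrite ?hV.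
Qed.

Lemma cunit_inM k (P : LR k -> Prop) a b : closed_subring P ->
  cunit_in P a -> cunit_in P b -> cunit_in P (a * b).
Proof.
move=> cP [aU Pa PaV] [bU Pb PbV]; split; first by rewrite unitrM aU.
  exact: csubM.
by rewrite invrM // ; apply: csubM.
Qed.

End Taylor.

(** * Inserting a variable into the tower, and extracting its coefficients *)

Section InsertVariable.
Variable R : comNzRingType.
Local Notation LR := (LR R).
Variable l : nat.

(* The new variable has level l + 1 (k < l is junk). *)
Fixpoint ins (k : nat) : {rmorphism LR k -> LR k.+1} :=
  match k return {rmorphism LR k -> LR k.+1} with
  | 0 => @lconst (LR 0)
  | k'.+1 => if (k' < l)%N then (@lconst (LR k'.+1) : {rmorphism LR k'.+1 -> LR k'.+2})
             else (lmap (ins k') : {rmorphism LR k'.+1 -> LR k'.+2})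
  end.

(** The coefficient of exponent c in the variable of level l + 1. The variables of higher level stay
    outside, so the extraction acts on their coefficients. *)
Fixpoint ext (c : int) (k : nat) : LR k.+1 -> LR k :=
  match k return LR k.+1 -> LR k with
  | 0 => fun f : lau (LR 0) => f c
  | k'.+1 => fun f : lau (LR k'.+1) =>
      if (k' < l)%N then f c else (mkLau (fun n => ext c (f n)) : LR k'.+1)
  end.

(** A constraint on the exponents of the variable of level l + 1 alone, at any depth of the tower; a
    tower of at most l levels does not contain this variable, whence [True]. *)
Fixpoint supp (S : int -> Prop) (k : nat) : LR k -> Prop :=
  match k return LR k -> Prop with
  | 0 => fun _ => True
  | k'.+1 => fun f : lau (LR k') =>
     if k' == l then forall n, ~ S n -> f n = 0
     else if (k' < l)%N then True else forall n, supp S (f n)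
  end.

Lemma ext_is_additive c k : additive (@ext c k).
Proof.
elim: k => [//|k IH] f g /=; case: ifP => // _.
have ext0 : ext c (0 : LR k.+1) = 0 by have := IH 0 0; rewrite !subr0 subrr.
have eb (h : lau (LR k.+1)) : lbounded (fun n => ext c (h n)).
  by have [b hb] := lau_bounded h; exists b => n /hb ->.
apply: lauP => n; rewrite LRD LRN !mkLauE //; exact: (eb (f - g)).
Qed.
HB.instance Definition _ c k :=
  GRing.isZmodMorphism.Build (LR k.+1) (LR k) (@ext c k) (@ext_is_additive c k).

Lemma ext_bounded c k (h : lau (LR k.+1)) : lbounded (fun n => ext c (h n)).
Proof. by have [b hb] := lau_bounded h; exists b => n /hb ->; rewrite raddf0. Qed.

Lemma ext_lt c k (f : LR k.+2) : (k < l)%N -> ext c f = (f : lau (LR k.+1)) c.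
Proof. by move=> kl; rewrite [ext _ _]/= kl. Qed.

Lemma ext_ge c k (f : LR k.+2) n : (k < l)%N = false ->
  (ext c f : lau (LR k)) n = ext c ((f : lau (LR k.+1)) n).
Proof. by move=> kl; rewrite [ext _ _]/= kl mkLauE //; apply: ext_bounded. Qed.

Lemma ins_lt k (a : LR k.+1) : (k < l)%N -> ins k.+1 a = (lconst a : LR k.+2).
Proof. by move=> kl; rewrite /= kl. Qed.

Lemma ins_ge k (a : LR k.+1) n : (k < l)%N = false ->
  (ins k.+1 a : lau (LR k.+1)) n = ins k ((a : lau (LR k)) n).
Proof. by move=> kl; rewrite /= kl. Qed.

(** This linearity over series free of the variable lets everything that does not involve u_1 leave
    the extraction. *)
Lemma ext_insM c k (a : LR k) (b : LR k.+1) : ext c (ins k a * b) = a * ext c b.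
Proof.
elim: k a b => [|k IH] a b; first exact: (@LR_lconstM R 0 a b c).
case kl : (k < l)%N; first by rewrite !ext_lt // ins_lt // LR_lconstM.
apply: lauP => n.
have [b1 ab1] := lau_bounded a; have [b2 bb2] := lau_bounded b.
have mb m : m < b1 -> (ins k.+1 a : lau (LR k.+1)) m = 0.
  by move=> mb; rewrite ins_ge // ab1 ?rmorph0.
have eb m : m < b2 -> (ext c b : lau (LR k)) m = 0.
  by move=> mb'; rewrite ext_ge // bb2 ?raddf0.
have nN : n - b1 - b2 < (absz (n - b1 - b2)%R).+1%:Z by lia.
rewrite ext_ge // (LRM ab1 eb nN) (LRM mb bb2 nN) raddf_sum; apply: eq_bigr => i _.
by rewrite ins_ge // ext_ge //; apply: IH.
Qed.

Lemma sums_ins k (s : nat -> LR k) a : sums s a -> sums (fun j => ins k (s j)) (ins k a).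
Proof.
elim: k s a => [|k IH] s a; first exact: sums_const.
case kl : (k < l)%N.
  move=> sa; rewrite ins_lt //; apply: eq_sums (sums_const sa) => j.
  by rewrite ins_lt.
move=> [[b sb] sa]; split; first by exists b => j n nb; rewrite ins_ge // sb ?rmorph0.
move=> n; rewrite ins_ge //; apply: eq_sums (IH _ _ (sa n)) => j.
by rewrite ins_ge.
Qed.

Lemma ins_cst k a : ins k (cst k a) = cst k.+1 a.
Proof.
elim: k => [//|k IH]; case kl : (k < l)%N; first by rewrite ins_lt.
apply: lauP => n; rewrite ins_ge // [cst _ _]/= [cst k.+2 _]/= !lconstE.
by case: eqP => _; rewrite ?rmorph0 // IH.
Qed.

Lemma small_const k (a : LR k) : small a -> small (lconst a : LR k.+1).
Proof.
move=> as_; split=> [n n0|]; last by rewrite lconstE eqxx.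
by rewrite lconstE ifF //; apply/negbTE; lia.
Qed.

Lemma small_ins k (a : LR k) : small a -> small (ins k a).
Proof.
elim: k a => [|k IH] a as_; first exact: (@small_const 0).
case kl : (k < l)%N; first by rewrite ins_lt //; apply: small_const.
case: as_ => a0 as_; split=> [n n0|]; rewrite ins_ge //; last exact: (IH _ as_).
by rewrite a0 ?rmorph0.
Qed.

Lemma valint_ins k (a : LR k) : valint a -> valint (ins k a).
Proof.
have constv k' (b : LR k') : valint b -> valint (lconst b : LR k'.+1).
  move=> bv; split=> [n n0|]; last by rewrite lconstE eqxx.
  by rewrite lconstE ifF //; apply/negbTE; lia.
elim: k a => [|k IH] a av; first exact: (@constv 0).
case kl : (k < l)%N; first by rewrite ins_lt //; apply: constv.
case: av => a0 av; split=> [n n0|]; rewrite ins_ge //; last exact: (IH _ av).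
by rewrite a0 ?rmorph0.
Qed.

Lemma ins_ser k c (a : LR k) : small a -> ins k (ser c a) = ser c (ins k a).
Proof.
move=> as_; apply/esym/lsumE; apply: eq_sums (sums_ins (serP c as_)) => j.
by rewrite rmorphM ins_cst rmorphXn.
Qed.

Lemma suppS S k (f : LR k.+1) : supp S f =
  if k == l then forall n, ~ S n -> (f : lau (LR k)) n = 0
  else if (k < l)%N then True else forall n, supp S ((f : lau (LR k)) n).
Proof. by []. Qed.

Lemma supp0 S k : supp S (0 : LR k).
Proof. by elim: k => [//|k IH]; rewrite suppS; case: ifP => // _; case: ifP. Qed.

Lemma suppD S k (f g : LR k) : supp S f -> supp S g -> supp S (f + g).
Proof.
elim: k f g => [//|k IH] f g; rewrite !suppS; case: ifP => [_ fS gS n nS|_].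
  by rewrite LRD fS ?gS ?addr0.
by case: ifP => // _ fS gS n; apply: (IH _ _ (fS n) (gS n)).
Qed.

Lemma supp_big_sum S k I (r : seq I) (F : I -> LR k) :
  (forall i, supp S (F i)) -> supp S (\sum_(i <- r) F i).
Proof. by move=> PF; apply: big_ind => //; [exact: supp0 | exact: suppD]. Qed.

Lemma suppM (S1 S2 S3 : int -> Prop) k (f g : LR k) :
  (forall a b, S1 a -> S2 b -> S3 (a + b)) ->
  supp S1 f -> supp S2 g -> supp S3 (f * g).
Proof.
move=> S123; elim: k f g => [//|k IH] f g; rewrite !suppS.
have [b fb] := lau_bounded f; have [c gc] := lau_bounded g.
have fgE n := LRM (N := (absz (n - b - c)%R).+1) fb gc (n := n) (ltac:(lia)).
case: ifP => [_ fS gS n nS|_].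
  rewrite fgE big1 // => i _.
  have [S1i|/fS->] := pselect (S1 (b + i%:Z)); last by rewrite mul0r.
  have [S2i|/gS->] := pselect (S2 (n - b - i%:Z)); last by rewrite mulr0.
  by case: nS; have := S123 _ _ S1i S2i; rewrite [X in S3 X](_ : _ = n) //; lia.
case: ifP => // _ fS gS n; rewrite fgE; apply: supp_big_sum => i.
exact: (IH _ _ (fS _) (gS _)).
Qed.

Lemma supp_sums S k (s : nat -> LR k) a : sums s a -> (forall j, supp S (s j)) -> supp S a.
Proof.
elim: k s a => [//|k IH] s a [_ sa]; rewrite suppS; under [in X in X -> _]eq_forall do rewrite suppS; case: ifP => [_ sS n nS|_].
  by apply: sums_uniq (sa n) _; apply: eq_sums (sums0 _ k) => j; rewrite sS.
case: ifP => // _ sS n; exact: (IH _ _ (sa n) (fun j => sS j n)).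
Qed.

Lemma supp_ins S k (a : LR k) : (l <= k)%N -> S 0 -> supp S (ins k a).
Proof.
move=> lk S0; elim: k lk a => [|k IH] lk a.
  rewrite /supp (_ : (0 == l)%N); last by lia.
  by move=> n nS; rewrite [ins 0 a]/= lconstE; case: eqP => // n0; case: nS; rewrite n0.
rewrite suppS; case: ifP => [/eqP lk1|/eqP lk1] /=.
  move=> n nS; rewrite ins_lt; last by lia.
  by rewrite lconstE; case: eqP => // n0; case: nS; rewrite n0.
rewrite ifF; last by lia.
by move=> n; rewrite ins_ge; [apply: IH; lia | lia].
Qed.

Lemma ext_supp S c k (f : LR k.+1) : (l <= k)%N -> ~ S c -> supp S f -> ext c f = 0.
Proof.
move=> lk nSc; elim: k lk f => [|k IH] lk f.
  rewrite /supp (_ : (0 == l)%N); last by lia.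
  by move=> /(_ c nSc).
rewrite suppS; case: ifP => [/eqP lk1|/eqP lk1].
  by rewrite ext_lt => [/(_ c nSc)|] //; lia.
rewrite ifF; last by lia.
move=> fS; apply: lauP => n; rewrite ext_ge; last by lia.
by apply: IH (fS n); lia.
Qed.

Definition regular k : LR k -> Prop := @supp (fun n => 0 <= n) k.

Lemma supp_cst S k a : S 0 -> supp S (cst k a).
Proof.
move=> S0; elim: k => [//|k IH]; rewrite suppS; case: ifP => [_ n nS|_].
  by rewrite /= -/(cst _ _); case: eqP => // n0; case: nS; rewrite n0.
by case: ifP => // _ n /=; case: eqP => // _; exact: supp0.
Qed.

Lemma closed_regular k : closed_subring (@regular k).
Proof.
split=> [a|f g|f g|s a]; [exact: supp_cst | exact: suppD | | exact: supp_sums].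
by apply: suppM => a b; apply: addr_ge0.
Qed.

End InsertVariable.

Global Opaque ser dquot dquot2.

(** * Partial fractions and residues *)

Lemma mulVV_sub (A : comUnitRingType) (a b : A) :
  a \is a GRing.unit -> b \is a GRing.unit -> b - a \is a GRing.unit ->
  a^-1 * b^-1 = (a^-1 - b^-1) * (b - a)^-1.
Proof.
move=> aU bU dU; apply: (mulIr dU); rewrite mulrVK // mulrBr -mulrA mulVr // mulr1.
by rewrite mulrAC mulVr // mul1r.
Qed.

Lemma partial_fractions (A : comUnitRingType) (I : eqType) (x : I -> A) (J : seq I) (u : A) :
  J != [::] -> uniq J -> {in J, forall j, u - x j \is a GRing.unit} ->
  {in J &, forall i j, i != j -> x i - x j \is a GRing.unit} ->
  \prod_(j <- J) (u - x j)^-1 =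
  \sum_(j <- J) (u - x j)^-1 * \prod_(l <- rem j J) (x j - x l)^-1.
Proof.
elim: J u => // i J IH u _ /= /andP[iJ uJ] uU xU.
have [->|J0] := eqVneq J [::]; first by rewrite !big_cons !big_nil eqxx big_nil addr0.
have xiU j : j \in J -> x i - x j \is a GRing.unit.
  move=> jJ; apply: xU; rewrite ?inE ?eqxx ?jJ ?orbT //.
  by apply: contraNneq iJ => ->.
have xU' : {in J &, forall i j, i != j -> x i - x j \is a GRing.unit}.
  by move=> j l jJ lJ; apply: xU; rewrite inE ?jJ ?lJ orbT.
(* The product over the tail is decomposed twice, at the point x_i and at u. The terms of index j
   then match through the two-factor identity for 1/((u - x_i)(u - x_j)). *)
rewrite !big_cons eqxx (IH (x i)) // (IH u) //; last first.
  by move=> j jJ; apply: uU; rewrite inE jJ orbT.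
rewrite !mulr_sumr -big_split /= big_seq [RHS]big_seq; apply: eq_bigr => j jJ.
have -> : (i == j) = false by apply: contraNF iJ => /eqP->.
rewrite big_cons.
have uiU : u - x i \is a GRing.unit by apply: uU; rewrite inE eqxx.
have ujU : u - x j \is a GRing.unit by apply: uU; rewrite inE jJ orbT.
have dE : (u - x j) - (u - x i) = x i - x j by rewrite opprB addrC addrA subrK.
rewrite !mulrA -mulrDl mulVV_sub // dE ?xiU //; congr (_ * _).
by rewrite -[x j - x i]opprB invrN mulrN -mulrBl.
Qed.

(** * Variables and their integer powers *)

Section Variables.
Variable R : comNzRingType.
Local Notation LR := (LR R).

(** A level l outside 1, ..., k gives 1, so powers are invertible with no condition on l. *)
Fixpoint lpow (k l : nat) (j : int) : LR k :=
  match k return LR k with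
  | 0 => 1
  | k'.+1 => if l == k'.+1 then lmono j 1 else lconst (lpow k' l j)
  end.

Definition y (k l : nat) : LR k := lpow k l 1.

Lemma lpowS_top k j : lpow k.+1 k.+1 j = (lmono j 1 : LR k.+1).
Proof. by rewrite /= eqxx. Qed.

Lemma lpowS k l j : l != k.+1 -> lpow k.+1 l j = (lconst (lpow k l j) : LR k.+1).
Proof. by move=> /negbTE /= ->. Qed.

Lemma lpowD k l i j : lpow k l i * lpow k l j = lpow k l (i + j).
Proof.
elim: k => [|k IH]; first by rewrite /= mulr1.
case: (eqVneq l k.+1) => [->|lk]; last by rewrite !lpowS // -IH rmorphM.
rewrite !lpowS_top; apply: lauP => n; rewrite LR_lmonoM !lmonoE mul1r.
by rewrite subr_eq addrC.
Qed.

Lemma lpow0 k l : lpow k l 0 = 1.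
Proof.
elim: k => //= k IH; case: ifP => // _; by rewrite IH rmorph1.
Qed.

Lemma lpow_inv k l j : lpow k l j \is a GRing.unit /\ (lpow k l j)^-1 = lpow k l (- j).
Proof. by apply: inv_eq; rewrite lpowD subrr lpow0. Qed.

Lemma y_unit k l : y k l \is a GRing.unit. Proof. by case: (lpow_inv k l 1). Qed.

Lemma yV k l : (y k l)^-1 = lpow k l (-1). Proof. by case: (lpow_inv k l 1). Qed.

Lemma lpowX k l j n : lpow k l j ^+ n = lpow k l (j *+ n).
Proof.
by elim: n => [|n IH]; rewrite ?expr0 ?mulr0n ?lpow0 // exprS IH lpowD mulrS.
Qed.

Lemma lmono_pos_small k j (a : LR k) : 0 < j -> small (lmono j a : LR k.+1).
Proof.
move=> j0; split=> [n n0|].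
  by rewrite lmonoE ifF //; apply/negbTE; lia.
have -> : (lmono j a : lau (LR k)) 0 = 0 by rewrite lmonoE ifF //; apply/negbTE; lia.
exact: small0.
Qed.

Lemma small_lpow k l j : (0 < l <= k)%N -> 0 < j -> small (lpow k l j).
Proof.
move=> + j0; elim: k => [|k IH]; first by lia.
case: (eqVneq l k.+1) => [->|lk] lk1; first by rewrite lpowS_top; apply: lmono_pos_small.
by rewrite lpowS //; apply: small_const; apply: IH; lia.
Qed.

Lemma small_y k l : (0 < l <= k)%N -> small (y k l).
Proof. by move=> lk; apply: small_lpow. Qed.

(** The expansion convention in one fact: the smaller variable is compared first, so the negative
    power of the larger one does no harm. *)
Lemma small_y_div k a b : (0 < a < b)%N -> (b <= k)%N -> small (y k b / y k a).
Proof.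
rewrite yV /y; elim: k => [|k IH] ab bk; first by lia.
case: (eqVneq b k.+1) => [bE|bk1].
  rewrite bE lpowS_top lpowS; last by lia.
  rewrite mulrC (_ : _ * _ = lmono 1 (lpow k a (-1)) :> LR k.+1); first exact: lmono_pos_small.
  apply: lauP => n; rewrite LR_lconstM !lmonoE.
  by case: eqP => _; rewrite ?mulr1 ?mulr0.
rewrite !lpowS //; last by lia.
by rewrite -rmorphM; apply: small_const; apply: IH; lia.
Qed.

Lemma ins_lpow_low l k i j : (i <= l)%N -> (l <= k)%N -> ins R l k (lpow k i j) = lpow k.+1 i j.
Proof.
move=> il; elim: k => [|k IH] lk.
  by rewrite lpowS //; lia.
case kl : (k < l)%N; first by rewrite ins_lt // (lpowS (k := k.+1)) //; lia.
apply: lauP => n; rewrite ins_ge // (lpowS (k := k.+1)); last by lia.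
have ik : i != k.+1 by lia.
rewrite (lpowS (k := k)) // !lconstE; case: eqP => _; rewrite ?rmorph0 // IH; last by lia.
by rewrite lpowS.
Qed.

Lemma ins_lpow_high l k i j : (l < i <= k)%N -> ins R l k (lpow k i j) = lpow k.+1 i.+1 j.
Proof.
elim: k => [|k IH] il; first by lia.
have kl : (k < l)%N = false by lia.
apply: lauP => n; rewrite ins_ge //; case: (eqVneq i k.+1) => [->|ik].
  by rewrite !lpowS_top !lmonoE; case: eqP => _; rewrite ?rmorph0 ?rmorph1.
rewrite (lpowS (k := k)) // (lpowS (k := k.+1)) ?eqSS //.
by rewrite !lconstE; case: eqP => _; rewrite ?rmorph0 // IH //; lia.
Qed.

Lemma supp_lpow l S k j : (l < k)%N -> S j -> supp l S (lpow k l.+1 j).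
Proof.
move=> + Sj; elim: k => [//|k IH] lk; rewrite suppS; case: ifP => [/eqP kl|/eqP kl].
  rewrite kl => n nS; rewrite lpowS_top lmonoE; case: eqP => // nj.
  by case: nS; rewrite nj.
case: ifP => // _ n; rewrite lpowS; last by lia.
rewrite lconstE; case: eqP => // _; [apply: IH; lia | exact: supp0].
Qed.

Lemma ext_lpow l c k j : (l <= k)%N -> ext l c (lpow k.+1 l.+1 j) = (c == j)%:R.
Proof.
elim: k => [|k IH] lk.
  have -> : l = 0%N by lia.
  by rewrite lpowS_top /= ; case: eqP.
case: (eqVneq l k.+1) => [lE|lk1].
  by rewrite ext_lt; [rewrite lE lpowS_top lmonoE; case: eqP | lia].
apply: lauP => n; rewrite ext_ge; last by lia.
rewrite lpowS; last by lia.
rewrite lconstE; case: eqP => [->|n0].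
  by rewrite IH; [case: eqP | lia].
rewrite raddf0; case: eqP => _ //.
by rewrite lauE1 lmonoE; case: eqP.
Qed.

Lemma sums_ext l c k (s : nat -> LR k.+1) a : sums s a ->
  sums (fun j => ext l c (s j)) (ext l c a).
Proof.
elim: k s a => [|k IH] s a; first by case=> _ /(_ c).
case kl : (k < l)%N.
  rewrite ext_lt // => -[_ /(_ c) sa].
  apply: (@eq_sums _ _ (fun j => (s j : lau (LR k.+1)) c)) sa => j.
  by rewrite ext_lt.
move=> [[b sb] sa]; split.
  by exists b => j n nb; rewrite ext_ge // sb ?raddf0.
move=> n; rewrite ext_ge //.
apply: eq_sums (IH (fun j => (s j : lau (LR k.+1)) n) _ (sa n)) => j.
by rewrite ext_ge.
Qed.

Lemma sums_delta k (x : LR k) i : sums (fun j => if j == i then x else 0) x.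
Proof.
elim: i => [|i IH].
  by apply: eq_sums (sums_single x) => -[|j].
by rewrite -[x in sums _ x]add0r; apply: eq_sums (sums_scons 0 IH) => -[|j].
Qed.

Lemma yE k l : y k l = lpow k l 1. Proof. by []. Qed.

End Variables.

(** * Values at a point and the residue at a simple pole *)

Section Residue.
Variable R : comNzRingType.
Local Notation LR := (LR R).
Variables (l k : nat).
Hypothesis lk : (l <= k)%N.
Local Notation u := (y R k.+1 l.+1).
Local Notation ins := (ins R l k).
Local Notation reg := (@regular R l k.+1).

Let creg : closed_subring reg := closed_regular R l k.+1.

Lemma reg_ins a : reg (ins a). Proof. exact: supp_ins. Qed.
Lemma reg_u : reg u. Proof. by rewrite yE; apply: supp_lpow. Qed.
Hint Resolve reg_ins reg_u : core.

(* [specializes x a b]: the function [a] of [u], regular at [u = x], takes the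
   value [b] there. *)
Definition specializes (x : LR k) (a : LR k.+1) (b : LR k) :=
  exists c, reg c /\ a = ins b + (u - ins x) * c.

Lemma specializes_reg x a b : specializes x a b -> reg a.
Proof. by move=> [c [rc ->]]; apply: csubD => //; apply: csubM => //; apply: csubB. Qed.

Lemma specializes_ins x b : specializes x (ins b) b.
Proof. by exists 0; rewrite mulr0 addr0; split=> //; exact: csub0. Qed.

Lemma specializes_u x : specializes x u x.
Proof. by exists 1; rewrite mulr1 addrC subrK; split=> //; exact: csub1. Qed.

Lemma specializesD x a b a' b' :
  specializes x a b -> specializes x a' b' -> specializes x (a + a') (b + b').
Proof.
move=> [c [rc ->]] [c' [rc' ->]]; exists (c + c'); split; first exact: csubD.
by rewrite rmorphD mulrDr addrACA.
Qed.

Lemma specializesM x a b a' b' :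
  specializes x a b -> specializes x a' b' -> specializes x (a * a') (b * b').
Proof.
move=> [c [rc ->]] sa'; have ra' := specializes_reg sa'; case: sa' => [c' [rc' a'E]].
exists (c * a' + ins b * c'); split; first by apply: csubD => //; apply: csubM.
by rewrite rmorphM mulrDl {1}a'E; ring.
Qed.

Lemma specializesN x a b : specializes x a b -> specializes x (- a) (- b).
Proof.
move=> sa; rewrite -[- a]mulN1r -[- b]mulN1r; apply: specializesM sa.
by rewrite -(rmorph1 ins) -rmorphN; apply: specializes_ins.
Qed.

Lemma specializesB x a b a' b' :
  specializes x a b -> specializes x a' b' -> specializes x (a - a') (b - b').
Proof. by move=> sa /specializesN; apply: specializesD. Qed.

Lemma specializes_prod x (I : eqType) (r : seq I) (F : I -> LR k.+1) (G : I -> LR k) :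
  {in r, forall i, specializes x (F i) (G i)} ->
  specializes x (\prod_(i <- r) F i) (\prod_(i <- r) G i).
Proof.
move=> FG; rewrite big_seq [X in specializes _ _ X]big_seq.
apply: (big_rec2 (fun a b => specializes x a b)); last first.
  by move=> i b a ir; apply: specializesM; apply: FG.
by rewrite -(rmorph1 ins); apply: specializes_ins.
Qed.

(** The series is never composed with a substitution: c(a) - c(b) is a multiple of a - b, and the
    cofactor is a difference quotient, regular because a and b are. *)
Lemma specializes_ser x c a b : small a -> small b ->
  specializes x a b -> specializes x (ser c a) (ser c b).
Proof.
move=> as_ bs sa; have ra := specializes_reg sa; case: sa => d [rd aE].
have ibs := small_ins l bs.
exists (d * dquot a (ins b) c); split.
  by apply: csubM => //; apply: csub_dquot => //.
rewrite ins_ser // mulrA; have <- : a - ins b = (u - ins x) * d.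
  by rewrite {1}aE addrC addKr.
by rewrite -ser_dquot // addrC subrK.
Qed.

Lemma specializesV x a b : cunit_in reg a -> b \is a GRing.unit ->
  specializes x a b -> specializes x a^-1 b^-1.
Proof.
move=> [aU ra raV] bU [c [rc aE]]; have ibU : ins b \is a GRing.unit by apply: rmorph_unit.
exists (- (a^-1 * ins b^-1 * c)); split.
  by apply: csubN => //; apply: csubM => //; apply: csubM.
have -> : (u - ins x) * - (a^-1 * ins b^-1 * c) = - (a^-1 * ins b^-1 * ((u - ins x) * c)).
  by ring.
have -> : (u - ins x) * c = a - ins b by rewrite {1}aE addrAC subrr add0r.
rewrite rmorphV // mulrBr [a^-1 * _ * a]mulrAC mulVr // mul1r -mulrA mulVr // mulr1.
by rewrite opprB addrC subrK.
Qed.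

(** Finds the value of a quotient by clearing a denominator u - z that does not vanish at x. It
    serves for h_i at another pole x_j, and with z = 0 for u/(u +_L [t](bar u)). *)
Lemma specializes_cancel x z a b : x - z \is a GRing.unit -> reg a ->
  specializes x (a * (u - ins z)) (b * (x - z)) -> specializes x a b.
Proof.
move=> xzU ra [c [rc aE]].
have ixzU : ins (x - z) \is a GRing.unit by apply: rmorph_unit.
exists (ins (x - z)^-1 * (c - a)); split; first by apply: csubM => //; apply: csubB.
apply: (mulIr ixzU); rewrite mulrDl -rmorphM.
have -> : (u - ins x) * (ins (x - z)^-1 * (c - a)) * ins (x - z) =
  (ins (x - z)^-1 * ins (x - z)) * ((u - ins x) * (c - a)) by ring.
rewrite -rmorphM mulVr // rmorph1 mul1r [(u - _) * _]mulrBr.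
have -> : (u - ins x) * c = a * (u - ins z) - ins (b * (x - z)).
  by rewrite aE addrAC subrr add0r.
rewrite rmorphM rmorphB.
by ring.
Qed.

Lemma sub_x_unit x : small (ins x / u) -> u - ins x \is a GRing.unit.
Proof.
move=> xu; have uU := y_unit R k.+1 l.+1.
have [U _ _] : cunit_in (fun=> True) (1 - ins x / u).
  by apply: cunit_in_small => //; rewrite addrC addrA addNr add0r; apply: smallN.
have -> : u - ins x = (1 - ins x / u) * u by rewrite mulrBl mul1r mulrVK.
by rewrite unitrM U.
Qed.

(** Write a = b + (u - x) c. After division by u - x the regular series c has no negative exponents
    and drops out; the rest is b u^-1 times the geometric series in x/u, whose term of exponent
    -(j+1) is b x^j. *)
Lemma residue x a b j : small (ins x / u) -> specializes x a b ->
  ext l (- j.+1%:Z) (a / (u - ins x)) = b * x ^+ j.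
Proof.
move=> xu [c [rc ->]]; have U := sub_x_unit xu; have uU := y_unit R k.+1 l.+1.
rewrite mulrDl mulrAC divrr // mul1r raddfD /= (ext_supp _ _ rc) // addr0 ext_insM.
congr (_ * _).
have [g gP] := summable_expr xu.
have -> : (u - ins x)^-1 = u^-1 * g.
  suff : (u - ins x) * (u^-1 * g) = 1 by case/inv_eq.
  rewrite -(geometric_sum gP) mulrA; congr (_ * _).
  by rewrite mulrBl divrr.
apply: sums_uniq (sums_ext l _ (sumsMl u^-1 gP)) _.
apply: eq_sums (sums_delta (x ^+ j) j) => i.
rewrite exprMn -rmorphXn mulrCA ext_insM -exprS yV lpowX ext_lpow //.
have -> : (- j.+1%:Z == -1 *+ i.+1) = (i == j) by rewrite mulNrn natz; lia.
by case: eqP => [->|_]; rewrite ?mulr1 ?mulr0.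
Qed.

End Residue.

Global Opaque y.

(** * The formal group law *)

Lemma prodM (A : comNzRingType) I (s : seq I) (F G : I -> A) :
  \prod_(i <- s) F i * \prod_(i <- s) G i = \prod_(i <- s) (F i * G i).
Proof. by rewrite big_split. Qed.

Section FormalGroup.
Variable R : comNzRingType.
Local Notation LR := (LR R).
Variables lg ex : nat -> R.
Hypotheses (lg0 : lg 0%N = 0) (lg1 : lg 1%N = 1) (ex0 : ex 0%N = 0).
Hypothesis exlg : seq_comp ex lg =1 @X_seq R.

Lemma ex1 : ex 1%N = 1.
Proof.
have := exlg 1; rewrite /seq_comp !big_ord_recl big_ord0 ex0 mul0r add0r addr0 /=.
by rewrite /cauchy !big_ord_recl big_ord0 lg0 mul0r add0r addr0 /= lg1 !mulr1.
Qed.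

Definition Lg k (z : LR k) := ser lg z.
Definition Ex k (z : LR k) := ser ex z.

Lemma Lg_small k (z : LR k) : small z -> small (Lg z).
Proof. by move=> zs; apply: small_ser. Qed.
Lemma Ex_small k (z : LR k) : small z -> small (Ex z).
Proof. by move=> zs; apply: small_ser. Qed.

Lemma ExLg k (z : LR k) : small z -> Ex (Lg z) = z.
Proof. by move=> zs; rewrite /Ex /Lg ser_ser // (ser_ext _ exlg) ser_X. Qed.

(* A left inverse [f] of [ex] exists, and it must agree with [lg]. *)
Lemma LgEx k (z : LR k) : small z -> Lg (Ex z) = z.
Proof.
move=> zs; have [f [f0 fex]] := comp_inv_exists ex0 ex1.
have fE w : small w -> ser f (Ex w : LR k) = w.
  by move=> ws; rewrite /Ex ser_ser // (ser_ext _ fex) ser_X.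
have LgE w : small w -> Lg (w : LR k) = ser f w.
  by move=> ws; rewrite -[in RHS](ExLg ws) fE //; apply: Lg_small.
by rewrite LgE ?fE //; apply: Ex_small.
Qed.

(* [twisted s a b] is the formal difference of [a] and [s]·[b]: the cases s = 1 and
   s = t give the two kinds of factors of the theorem. *)
Definition twisted k (s a b : LR k) := Ex (Lg a - s * Lg b).
(* exp' (log z) = 1 / log' z, the paper's P(z); see [tau_Pser]. *)
Definition dlog_inv k (z : LR k) := ser (seq_deriv ex) (Lg z).
Definition tw_ratio k (a b : LR k) := twisted (y R k 1) a b * (twisted 1 a b)^-1.

Lemma twistedE k (s a b : LR k) : twisted s a b = Ex (Lg a - s * Lg b).
Proof. by []. Qed.
Lemma dlog_invE k (z : LR k) : dlog_inv z = ser (seq_deriv ex) (ser lg z).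
Proof. by []. Qed.

Lemma small1M k (p q : LR k) : small (p - 1) -> small (q - 1) -> small (p * q - 1).
Proof.
move=> ps qs; have -> : p * q - 1 = (p - 1) * (q - 1) + ((p - 1) + (q - 1)) by ring.
by apply: smallD; [apply: smallMl => //; apply: small_valint | apply: smallD].
Qed.

Lemma valint_small1 k (q : LR k) : small (q - 1) -> valint q.
Proof.
move=> qs; rewrite -[q](subrK 1); apply: valintD (valint1 _ k).
exact: small_valint.
Qed.

(** Second-order Taylor expansion of exp at log b, evaluated at log a; the linear coefficient
    exp'(log b) is P(b). *)
Lemma sub_dlog_expand k (a b : LR k) : small a -> small b ->
  a - b = (Lg a - Lg b) * ((Lg a - Lg b) * dquot2 (Lg a) (Lg b) ex + dlog_inv b).
Proof.
move=> as_ bs; have e1 := ser_dquot (Lg_small as_) (Lg_small bs) ex.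
have -> : a - b = Ex (Lg a) - Ex (Lg b) by rewrite !ExLg.
rewrite e1; congr (_ * _); apply/(canRL (subrK _)).
exact: (dquot_dquot2 (Lg_small as_) (Lg_small bs)).
Qed.

Section Closed.
Variables (k : nat) (P : LR k -> Prop).
Hypothesis cP : closed_subring P.

Lemma csub_Lg z : small z -> P z -> P (Lg z).
Proof. exact: csub_ser. Qed.
Lemma csub_twisted s a b : valint s -> small a -> small b ->
  P s -> P a -> P b -> P (twisted s a b).
Proof.
move=> sv as_ bs Ps Pa Pb; apply: csub_ser => //.
  by apply: smallB; [exact: Lg_small | apply: smallMl => //; exact: Lg_small].
by apply: csubB => //; [exact: csub_Lg | apply: csubM => //; exact: csub_Lg].
Qed.

Lemma Lg_factor a : small a -> P a -> exists q, [/\ Lg a = a * q, P q & small (q - 1)].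
Proof.
move=> as_ Pa; have [q [aq Pq qs]] := ser_factor as_ lg0 cP Pa.
by exists q; split=> //; rewrite lg1 rmorph1 in qs.
Qed.

Lemma Ex_factor a : small a -> P a -> exists q, [/\ Ex a = a * q, P q & small (q - 1)].
Proof.
move=> as_ Pa; have [q [aq Pq qs]] := ser_factor as_ ex0 cP Pa.
by exists q; split=> //; rewrite ex1 rmorph1 in qs.
Qed.

Lemma twisted1_factor a b : small a -> small b -> P a -> P b ->
  exists h, [/\ twisted 1 a b = (a - b) * h, P h & small (h - 1)].
Proof.
move=> as_ bs Pa Pb; rewrite /twisted mul1r.
have zs : small (Lg a - Lg b) by apply: smallB; apply: Lg_small.
have [|q [-> Pq qs]] := Ex_factor zs.
  by apply: csubB => //; apply: csub_Lg.
exists (dquot a b lg * q); split; first by rewrite /Lg ser_dquot // mulrA.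
  by apply: csubM => //; apply: csub_dquot.
by apply: small1M => //; have := dquot_small as_ bs lg; rewrite lg1 rmorph1.
Qed.

(** When b/a is infinitesimal, a dominates: log a - s log b is a times 1 + small, for any s without
    negative valuation. *)
Lemma twisted_factor s a b : valint s -> small a -> small b -> a \is a GRing.unit ->
  small (b / a) -> P s -> P a -> P b -> P (b / a) ->
  exists h, [/\ twisted s a b = a * h, P h & small (h - 1)].
Proof.
move=> sv as_ bs aU bas Ps Pa Pb Pba; rewrite /twisted.
have [qa [La Pqa qas]] := Lg_factor as_ Pa; have [qb [Lb Pqb qbs]] := Lg_factor bs Pb.
have [||q [-> Pq qs]] := @Ex_factor (Lg a - s * Lg b).
- by apply: smallB; [exact: Lg_small | apply: smallMl => //; exact: Lg_small].
- by apply: csubB => //; [exact: csub_Lg | apply: csubM => //; exact: csub_Lg].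
exists ((qa - s * (b / a) * qb) * q); split.
- rewrite mulrA La Lb; congr (_ * _).
  rewrite mulrBr; congr (_ - _).
  by rewrite -[in LHS](mulrVK aU b); ring.
- by apply: csubM => //; apply: csubB => //; apply: csubM => //; apply: csubM.
apply: small1M => //; rewrite addrAC; apply: smallB => //.
by apply: smallMr; [apply: smallMl | apply: valint_small1].
Qed.

(** Here log a - s log a = (1 - s) log a. The indeterminate t is itself an infinitesimal variable,
    so 1 - t is a unit and this covers u +_L [t](bar u). *)
Lemma twisted_self_factor s a : small s -> small a -> P s -> P a ->
  exists h, [/\ twisted s a a = a * h, P h & small (h - 1)].
Proof.
move=> ss as_ Ps Pa; rewrite /twisted.
have [qa [La Pqa qas]] := Lg_factor as_ Pa.
have sv := small_valint ss.
have [||q [-> Pq qs]] := @Ex_factor (Lg a - s * Lg a).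
- by apply: smallB; [exact: Lg_small | apply: smallMl => //; exact: Lg_small].
- by apply: csubB => //; [exact: csub_Lg | apply: csubM => //; exact: csub_Lg].
exists ((1 - s) * qa * q); split.
- by rewrite La; ring.
- by apply: csubM => //; apply: csubM => //; apply: csubB => //; apply: csub1.
apply: small1M => //; apply: small1M => //.
by rewrite addrC addrA addNr add0r; apply: smallN.
Qed.

Lemma dlog_inv_factor z : small z -> P z -> P (dlog_inv z) /\ small (dlog_inv z - 1).
Proof.
move=> zs Pz; split; first by apply: csub_ser => //; [exact: Lg_small | exact: csub_Lg].
have /sums_behead := serP (seq_deriv ex) (Lg_small zs).
rewrite expr0 mulr1 /seq_deriv ex1 mulr1n rmorph1 => /small_sums; apply=> j.
by apply: smallMl; [exact: valint_cst | apply: small_expr; apply: Lg_small].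
Qed.
End Closed.

Section Insert.
Variables (l k : nat).
Local Notation ins := (ins R l k).

Lemma ins_Lg a : small a -> ins (Lg a) = Lg (ins a).
Proof. exact: ins_ser. Qed.

Lemma ins_twisted s a b : valint s -> small a -> small b ->
  ins (twisted s a b) = twisted (ins s) (ins a) (ins b).
Proof.
move=> sv as_ bs; rewrite /twisted /Ex ins_ser ?rmorphB ?rmorphM ?ins_Lg //.
by apply: smallB; [exact: Lg_small | apply: smallMl => //; exact: Lg_small].
Qed.

Lemma ins_dlog_inv a : small a -> ins (dlog_inv a) = dlog_inv (ins a).
Proof. by move=> as_; rewrite /dlog_inv ins_ser ?ins_Lg //; apply: Lg_small. Qed.
End Insert.

Lemma valint_y1 k : valint (y R k.+1 1).
Proof. by apply/small_valint/small_y. Qed.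

(** * One extraction: the residues in a single variable u *)

Section Step.
Variables (l k : nat).
Hypothesis l0 : (0 < l <= k)%N.
Let lk : (l <= k)%N. Proof. by case/andP: l0. Qed.
Local Notation u := (y R k.+1 l.+1).
Local Notation ins := (ins R l k).
Local Notation reg := (@regular R l k.+1).
Local Notation t := (y R k 1).
Local Notation t' := (y R k.+1 1).
Let creg : closed_subring reg := closed_regular R l k.+1.
Let regins a : reg (ins a) := reg_ins lk a.
Let regu : reg u := reg_u R lk.

Lemma ins_y1 : ins t = t'.
Proof. by rewrite !yE; apply: ins_lpow_low => //; case/andP: l0. Qed.

Let us : small u. Proof. by apply: small_y; lia. Qed.
Let ts : small t. Proof. by apply: small_y; lia. Qed.
Let ts' : small t'. Proof. by apply: small_y. Qed.
Let regt : reg t'. Proof. by rewrite -ins_y1. Qed.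
Let valt := small_valint ts.
Let valt' := small_valint ts'.
Let one_ins : 1 = ins 1. Proof. by rewrite rmorph1. Qed.

Lemma specializes_twisted x s a b a' b' : valint s ->
  small a -> small b -> small a' -> small b' ->
  specializes l x a a' -> specializes l x b b' ->
  specializes l x (twisted (ins s) a b) (twisted s a' b').
Proof.
move=> sv as_ bs a's b's aa bb; have isv : valint (ins s) by apply: valint_ins.
apply: specializes_ser => //.
- by apply: smallB; [exact: Lg_small | apply: smallMl => //; exact: Lg_small].
- by apply: smallB; [exact: Lg_small | apply: smallMl => //; exact: Lg_small].
apply: specializesB => //; first exact: specializes_ser.
by apply: specializesM => //; [exact: specializes_ins | exact: specializes_ser].
Qed.

Lemma ins_ratio a b : small a -> small b -> twisted 1 a b \is a GRing.unit ->
  ins (tw_ratio a b) = tw_ratio (ins a) (ins b).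
Proof.
move=> as_ bs U; have e1 := ins_twisted l (valint1 R k) as_ bs; rewrite rmorph1 in e1.
have et := ins_twisted l valt as_ bs; rewrite ins_y1 in et.
by rewrite /tw_ratio [LHS]rmorphM (rmorphV ins U) e1 et.
Qed.

(** The quotient h = (u +_L bar x)/(u - x) is the difference quotient of log at u and x times that
    of exp at log u - log x and 0. At u = x the first is log'(x) = 1/P(x) and the second is exp'(0)
    = 1. *)
Lemma twisted1_specializes x : small x -> small (ins x / u) ->
  [/\ twisted 1 u (ins x) \is a GRing.unit, cunit_in reg (twisted 1 u (ins x) / (u - ins x)),
      dlog_inv x \is a GRing.unit &
      specializes l x (twisted 1 u (ins x) / (u - ins x)) (dlog_inv x)^-1].
Proof.
move=> xs xu; have ixs := small_ins l xs.
have dU := sub_x_unit xu.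
have [h [hE regh hs]] := twisted1_factor creg us ixs regu (regins x).
have hC := cunit_in_small creg hs regh; have [hU _ _] := hC.
have -> : twisted 1 u (ins x) / (u - ins x) = h by rewrite hE mulrAC divrr // mul1r.
have PU : dlog_inv x \is a GRing.unit.
  have [Pv Ps] := dlog_inv_factor (closed_valint R k) xs (small_valint xs).
  by have [] := cunit_in_small (closed_valint R k) Ps Pv.
split=> //; first by rewrite hE unitrM dU.
pose d := u - ins x; pose q1 := dquot u (ins x) lg.
have q1E : Lg u - Lg (ins x) = d * q1 by rewrite /Lg ser_dquot.
have zs : small (d * q1) by rewrite -q1E; apply: smallB; apply: Lg_small.
have regd : reg d by apply: csubB.
have regq1 : reg q1 by apply: csub_dquot.
have q1s : specializes l x (q1 * ins (dlog_inv x)) 1.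
  pose w := dquot2 (Lg u) (Lg (ins x)) ex.
  have regw : reg w.
    by apply: csub_dquot2 => //; try exact: Lg_small; apply: csub_Lg.
  (* Cancelling the unit d from d = d q1 (P(x) + d q1 w) leaves q1 P(x) = 1 - d q1^2 w, which
     exhibits the cofactor. *)
  exists (- (q1 * q1 * w)); split.
    by apply: csubN => //; apply: csubM => //; apply: csubM.
  have dE : d = d * (q1 * (ins (dlog_inv x) + d * q1 * w)).
    have := sub_dlog_expand us ixs; rewrite q1E -ins_dlog_inv // -/d -/w => e1.
    by rewrite {1}e1 -mulrA [_ + ins _]addrC.
  have := congr1 (fun e => d^-1 * e) dE; rewrite mulKr // mulVr // => {}dE.
  by rewrite rmorph1 {1}dE -/d; ring.
have hq : h = q1 * dquot (d * q1) 0 ex.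
  apply: (mulrI dU); rewrite -hE mulrA -/d /twisted mul1r q1E.
  have := ser_dquot zs (small0 R k.+1) ex; rewrite ser0 ex0 rmorph0 !subr0.
  exact.
have q2s : specializes l x (dquot (d * q1) 0 ex) 1.
  have regz : reg (d * q1) by apply: csubM.
  have reg0 : reg 0 by apply: csub0.
  exists (q1 * dquot2 (d * q1) 0 ex); split.
    by apply: csubM => //; apply: csub_dquot2 => //; exact: small0.
  have := dquot_dquot2 zs (small0 R k.+1) ex; rewrite ser0 /seq_deriv ex1 mulr1n subr0.
  by move/(canRL (subrK _)) ->; rewrite !rmorph1 mulrA addrC.
rewrite -[h](mulrK (rmorph_unit ins PU)) -rmorphV // -[X in specializes _ _ _ X]mul1r.
apply: (specializesM lk); last exact: specializes_ins.
by rewrite hq mulrAC -[1]mul1r; apply: (specializesM lk).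
Qed.

(** J indexes the poles x_j still present, V lists the larger variables u_i still to be extracted,
    and fu is the prefactor that separates HP from HQ, with value fx j at the pole x_j. *)
Variables (J : seq nat) (x : nat -> LR k) (V : seq (LR k)) (fu : LR k.+1) (fx : nat -> LR k).
Hypotheses (uJ : uniq J).
Hypothesis xs : {in J, forall j, small (x j)}.
Hypothesis xus : {in J, forall j, small (ins (x j) / u)}.
Hypothesis xU : {in J &, forall i j, i != j -> x i - x j \is a GRing.unit}.
Hypothesis Vs : {in V, forall z, [/\ small z, z \is a GRing.unit & small (u / ins z)]}.
Hypothesis xVs : {in V & J, forall z j, small (x j / z)}.
Hypothesis fuP : {in J, forall j, specializes l (x j) fu (fx j)}.
Hypothesis fur : reg fu.

Lemma twisted1_unit k' (a b : LR k') : small a -> small b -> a - b \is a GRing.unit ->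
  twisted 1 a b \is a GRing.unit.
Proof.
move=> as_ bs dU; have [h [-> hv hs]] :=
  twisted1_factor (closed_valint R k') as_ bs (small_valint as_) (small_valint bs).
by have [hU _ _] := cunit_in_small (closed_valint R k') hs hv; rewrite unitrM dU.
Qed.

Let h i := twisted 1 u (ins (x i)) / (u - ins (x i)).
(** The value of h_i at u = x_j. On the diagonal the quotient reads 0/0, and its true value is
    1/P(x_j). *)
Let hval j i := if i == j then (dlog_inv (x j))^-1
                else twisted 1 (x j) (x i) / (x j - x i).

Let h_spec : {in J &, forall j i, specializes l (x j) (h i) (hval j i)}.
Proof.
move=> j i jJ iJ; rewrite /h /hval; case: eqVneq => [->|ij].
  by have [] := twisted1_specializes (xs jJ) (xus jJ).
have dU : x j - x i \is a GRing.unit by apply: xU; rewrite // eq_sym.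
apply: (specializes_cancel lk dU).
  by have [_ []] := twisted1_specializes (xs iJ) (xus iJ).
rewrite !mulrVK //; last exact/sub_x_unit/xus.
rewrite one_ins; apply: specializes_twisted => //; try exact: xs.
- exact: valint1.
- by apply: small_ins; apply: xs.
- exact: specializes_u.
- exact: specializes_ins.
Qed.

Let hval_unit : {in J &, forall j i, hval j i \is a GRing.unit}.
Proof.
move=> j i jJ iJ; rewrite /hval; case: eqVneq => [_|ij].
  by rewrite unitrV; have [] := twisted1_specializes (xs jJ) (xus jJ).
have dU : x j - x i \is a GRing.unit by apply: xU; rewrite // eq_sym.
by rewrite unitrM unitrV dU andbT; apply: twisted1_unit => //; apply: xs.
Qed.

Let V_unit z : z \in V -> cunit_in reg (twisted t' (ins z) u).
Proof.
move=> /Vs[zs zU uz].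
have izU : ins z \is a GRing.unit by apply: rmorph_unit.
have reguz : reg (u / ins z) by rewrite -rmorphV //; apply: csubM.
have [w [-> regw ws]] := twisted_factor creg valt' (small_ins l zs) us izU uz
  regt (regins z) regu reguz.
apply: cunit_inM => //; last exact: cunit_in_small.
by split=> //; rewrite -rmorphV.
Qed.

Let Vx_unit z j : z \in V -> j \in J -> twisted t z (x j) \is a GRing.unit.
Proof.
move=> zV jJ; have [zs zU _] := Vs zV.
have xzs := xVs zV jJ.
have [w [-> vw ws]] := twisted_factor (closed_valint R k) valt zs (xs jJ) zU xzs
  valt (small_valint zs) (small_valint (xs jJ)) (small_valint xzs).
by have [wU _ _] := cunit_in_small (closed_valint R k) ws vw; rewrite unitrM zU.
Qed.

Lemma dlog_inv_cunit k' (P : LR k' -> Prop) z : closed_subring P -> small z -> P z ->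
  cunit_in P (dlog_inv z).
Proof.
by move=> cP zs Pz; have [Pv Ps] := dlog_inv_factor cP zs Pz; apply: cunit_in_small.
Qed.

(** Each pole x_j contributes one summand. The denominator of its own ratio yields P(x_j), which
    absorbs 1/P(u), and its numerator survives as x_j +_L [t](bar x_j); the other ratios and the
    factors with V take their values at x_j. *)
Lemma residue_sum p :
  ext l (- p.+1%:Z) (fu * (dlog_inv u)^-1 * \prod_(j <- J) tw_ratio u (ins (x j)) *
     \prod_(z <- V) (twisted 1 (ins z) u * (twisted t' (ins z) u)^-1)) =
  \sum_(j <- J) fx j * twisted t (x j) (x j) * x j ^+ p *
     \prod_(i <- rem j J) tw_ratio (x j) (x i) *
     \prod_(z <- V) (twisted 1 z (x j) * (twisted t z (x j))^-1).
Proof.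
(* The series stripped of its simple poles 1/(u - x_j): what remains of each denominator is the
   regular unit h_j. *)
pose G := fu * (dlog_inv u)^-1 * \prod_(j <- J) (twisted t' u (ins (x j)) * (h j)^-1) *
     \prod_(z <- V) (twisted 1 (ins z) u * (twisted t' (ins z) u)^-1).
pose Gv j := fx j * (dlog_inv (x j))^-1 *
     \prod_(i <- J) (twisted t (x j) (x i) * (hval j i)^-1) *
     \prod_(z <- V) (twisted 1 z (x j) * (twisted t z (x j))^-1).
have hC : {in J, forall i, cunit_in reg (h i)}.
  by move=> i iJ; have [] := twisted1_specializes (xs iJ) (xus iJ).
have PuC : cunit_in reg (dlog_inv u) by apply: dlog_inv_cunit.
have Gspec : {in J, forall j, specializes l (x j) G (Gv j)}.
  move=> j jJ; apply: specializesM => //; [apply: specializesM => //; [apply: specializesM => //|]|].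
  - exact: fuP.
  - apply: specializesV => //; first by have [] := twisted1_specializes (xs jJ) (xus jJ).
    apply: specializes_ser => //; try exact: Lg_small; first exact/Lg_small/xs.
    by apply: specializes_ser => //; [exact: xs | exact: specializes_u].
  - apply: specializes_prod => // i iJ; apply: specializesM => //.
      rewrite -ins_y1; apply: specializes_twisted => //; try exact: xs.
      + by apply: small_ins; apply: xs.
      + exact: specializes_u.
      + exact: specializes_ins.
    by apply: specializesV; [| apply: hC | apply: hval_unit | apply: h_spec].
  - apply: specializes_prod => // z zV; have [zs zU uz] := Vs zV.
    apply: specializesM => //.
      rewrite one_ins; apply: specializes_twisted => //; try exact: xs.
      + exact: valint1.
      + exact: small_ins.
      + exact: specializes_ins.
      + exact: specializes_u.
    have tsp := specializes_twisted valt (small_ins l zs) us zs (xs jJ)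
      (specializes_ins l (x j) z) (specializes_u l (x j)).
    by rewrite ins_y1 in tsp; apply: (specializesV lk (V_unit zV) (Vx_unit zV jJ)).
have -> : fu * (dlog_inv u)^-1 * \prod_(j <- J) tw_ratio u (ins (x j)) *
     \prod_(z <- V) (twisted 1 (ins z) u * (twisted t' (ins z) u)^-1) =
   G * \prod_(j <- J) (u - ins (x j))^-1.
  have -> : \prod_(j <- J) tw_ratio u (ins (x j)) =
      \prod_(j <- J) (twisted t' u (ins (x j)) * (h j)^-1) *
      \prod_(j <- J) (u - ins (x j))^-1.
    rewrite prodM; apply: eq_big_seq => j jJ.
    have [_ [hU _ _] _ _] := twisted1_specializes (xs jJ) (xus jJ).
    have dU := sub_x_unit (xus jJ).
    have e : (h j)^-1 * (u - ins (x j))^-1 = (twisted 1 u (ins (x j)))^-1.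
      by rewrite -(invrM dU hU); congr (_^-1); rewrite mulrC; exact: (mulrVK dU).
    by rewrite /tw_ratio -e mulrA.
  rewrite /G; move: (fu / _) (\prod_(z <- V) _) (\prod_(j <- J) (_ / h _)) => a b c.
  by rewrite mulrA [RHS]mulrAC.
(* Partial fractions need at least one pole. Without any, the series is regular in u, so its
   coefficient at a negative exponent is 0, the empty sum. *)
have [J0|J0] := eqVneq J [::].
  rewrite J0 !big_nil mulr1 /G J0 big_nil mulr1 (@ext_supp R l (fun n => 0 <= n) _ _ _ lk) //.
  apply: csubM => //; first by apply: csubM => //; case: PuC.
  apply: csub_big_prod => // z zV _; have [zs _ _] := Vs zV; have [_ _ rV] := V_unit zV.
  apply: csubM => //.
  exact: (csub_twisted creg (valint1 R k.+1) (small_ins l zs) us (csub1 creg) (regins z) regu).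
have xuU : {in J, forall j, u - ins (x j) \is a GRing.unit}.
  by move=> j jJ; apply: sub_x_unit; apply: xus.
have ixU : {in J &, forall i j, i != j -> ins (x i) - ins (x j) \is a GRing.unit}.
  by move=> i j iJ jJ ij; rewrite -rmorphB; apply: rmorph_unit; apply: xU.
rewrite partial_fractions // mulr_sumr raddf_sum big_seq [RHS]big_seq /=.
apply: eq_bigr => j jJ.
have -> : \prod_(i <- rem j J) (ins (x j) - ins (x i))^-1 =
    ins (\prod_(i <- rem j J) (x j - x i)^-1).
  rewrite rmorph_prod; apply: eq_big_seq => i.
  rewrite mem_rem_uniq // inE => /andP[ij iJ].
  by rewrite rmorphV ?rmorphB //; apply: xU; rewrite // eq_sym.
rewrite [G * _]mulrA [G / _ * _]mulrC ext_insM (residue lk _ (xus jJ) (Gspec _ jJ)).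
(* The index i = j is split off: its factor is (x_j +_L [t](bar x_j)) P(x_j), and P(x_j) meets the
   value of 1/P(u). *)
rewrite /Gv (big_rem j jJ) /= {1}/hval eqxx invrK.
have PU : dlog_inv (x j) \is a GRing.unit.
  by have [] := twisted1_specializes (xs jJ) (xus jJ).
have -> : \prod_(i <- rem j J) tw_ratio (x j) (x i) =
   \prod_(i <- rem j J) (x j - x i)^-1 *
   \prod_(i <- rem j J) (twisted t (x j) (x i) / hval j i).
  rewrite prodM; apply: eq_big_seq => i.
  rewrite mem_rem_uniq // inE => /andP[ij iJ].
  have dU : x j - x i \is a GRing.unit by apply: xU; rewrite // eq_sym.
  have U := twisted1_unit (xs jJ) (xs iJ) dU.
  rewrite /hval (negbTE ij) invrM ?unitrV // invrK /tw_ratio mulrCA; congr (_ * _).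
  by rewrite mulrA mulVr // mul1r.
set A := \prod_(i <- _) (x j - x i)^-1; set B := \prod_(i <- _) _; set C := \prod_(z <- V) _.
have -> : fx j / dlog_inv (x j) * (twisted t (x j) (x j) * dlog_inv (x j) * B) * C * x j ^+ p
   = (dlog_inv (x j))^-1 * dlog_inv (x j) * (fx j * (twisted t (x j) (x j) * B) * C * x j ^+ p)
  by ring.
by rewrite mulVr // mul1r; ring.
Qed.

End Step.
End FormalGroup.

(** * Comparison with the function-based series *)

Section Transfer.
Variable R : comNzRingType.
Local Notation LR := (LR R).
Local Notation LT := (LT R).

(** The series of the statement are bare functions. Forgetting the boundedness proofs embeds the
    rings into them, and every operation specified there by [epsilon] is to be identified on the
    image. *)
Fixpoint tau (k : nat) : LR k -> LT k :=
  match k return LR k -> LT k with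
  | 0 => id
  | k'.+1 => fun (f : lau (LR k')) n => tau (f n)
  end.

Lemma tau_inj k (f g : LR k) : tau f = tau g -> f = g.
Proof.
elim: k f g => [//|k IH] f g fg; apply: lauP => n; apply: IH.
exact: (congr1 (fun h => h n) fg).
Qed.

Lemma tau0 k : tau (0 : LR k) = lzero R k.
Proof. by elim: k => [//|k IH]; apply: funext => n /=; rewrite IH. Qed.

Lemma tau_cst k a : tau (cst k a) = lcst k a.
Proof.
elim: k => [//|k IH]; apply: funext => n /=; case: eqP => _; first exact: IH.
exact: tau0.
Qed.

Lemma tau1 k : tau (1 : LR k) = lone R k.
Proof. by rewrite -(rmorph1 (@cst R k)) tau_cst. Qed.

Lemma tauD k (f g : LR k) : tau (f + g) = ladd (tau f) (tau g).
Proof. by elim: k f g => [//|k IH] f g; apply: funext => n /=; rewrite -IH. Qed.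

Lemma tauN k (f : LR k) : tau (- f) = lopp (tau f).
Proof. by elim: k f => [//|k IH] f; apply: funext => n /=; rewrite -IH. Qed.

Lemma tau_sum k I (s : seq I) (F : I -> LR k) :
  tau (\sum_(i <- s) F i) = lsumL [seq tau (F i) | i <- s].
Proof.
elim: s => [|i s IH]; first by rewrite big_nil tau0.
by rewrite big_cons tauD IH.
Qed.

(** Whatever bound [epsilon] selects is a valid one on the image of [tau]; it may differ from the
    bound used in the ring, which is harmless because the convolution is independent of it. *)
Lemma lbnd_spec k (f : LR k.+1) n :
  n < lbnd (lzero R k) (tau f) -> (f : lau (LR k)) n = 0.
Proof.
have := ClassicalEpsilon.epsilon_spec (inhabits (0 : int))
  (fun b : int => forall n : int, n < b -> tau f n = lzero R k).
rewrite -/(lbnd _ _) => sp nb; apply: tau_inj; rewrite tau0; apply: sp nb.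
by have [b fb] := lau_bounded f; exists b => i ib /=; rewrite fb ?tau0.
Qed.

Lemma tauM k (f g : LR k) : tau (f * g) = lmul (tau f) (tau g).
Proof.
elim: k f g => [//|k IH] f g; apply: funext => n.
pose bf := lbnd (lzero R k) (tau f); pose bg := lbnd (lzero R k) (tau g).
have fb := @lbnd_spec k f; have gb := @lbnd_spec k g.
have nN : n - bf - bg < (tonat (n - bf - bg + 1))%:Z.
  by case: (n - bf - bg) => [i|i] /=; [lia|case: i => [|i] /=; lia].
change (tau ((f * g : lau (LR k)) n) = lmul (tau f) (tau g) n).
rewrite (LRM fb gb nN) -(big_mkord xpredT
  (fun i => (f : lau (LR k)) (bf + i%:Z) * (g : lau (LR k)) (n - bf - i%:Z))).
rewrite /index_iota subn0 tau_sum /=; congr (lsumL _); apply: eq_map => i.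
by rewrite IH.
Qed.

Lemma tau_prod k (I : eqType) (s : seq I) (F : I -> LR k) (G : I -> LT k) :
  {in s, forall i, G i = tau (F i)} -> lprodL [seq G i | i <- s] = tau (\prod_(i <- s) F i).
Proof.
elim: s => [|i s IH] GF; first by rewrite big_nil tau1.
rewrite big_cons tauM -IH => [|j js]; last by apply: GF; rewrite inE js orbT.
by rewrite /= GF // inE eqxx.
Qed.

Lemma tau_sum_in k (I : eqType) (s : seq I) (F : I -> LR k) (G : I -> LT k) :
  {in s, forall i, G i = tau (F i)} -> lsumL [seq G i | i <- s] = tau (\sum_(i <- s) F i).
Proof. by move=> GF; rewrite tau_sum; congr lsumL; apply/eq_in_map. Qed.

Lemma tauX k (f : LR k) j : lexp (tau f) j = tau (f ^+ j).
Proof. by elim: j => [|j IH]; rewrite ?expr0 ?tau1 // exprS tauM -IH. Qed.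

Lemma tau_lwf k (f : LR k) : lwf (tau f).
Proof.
elim: k f => [//|k IH] f; split=> [|n]; last exact: IH.
by have [b fb] := lau_bounded f; exists b => n nb /=; rewrite fb ?tau0.
Qed.

Lemma lwf_tau k (g : LT k) : lwf g -> exists f, g = tau f.
Proof.
elim: k g => [|k IH] g; first by exists g.
move=> [[b gb] gw]; have /choice [f fP] := fun n => IH _ (gw n).
have fb : lbounded f.
  by exists b => n nb; apply: tau_inj; rewrite -fP tau0 gb.
by exists (Lau fb); apply: funext => n; rewrite fP.
Qed.

(** [linv] selects some well-formed inverse; well-formed functions come from the ring, where
    inverses are unique. *)
Lemma tauV k (f : LR k) : f \is a GRing.unit -> linv (tau f) = tau f^-1.
Proof.
move=> fU; rewrite /linv.
set Q := fun g => _; have [] : Q (ClassicalEpsilon.epsilon (inhabits (lzero R k)) Q).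
  apply: ClassicalEpsilon.epsilon_spec; exists (tau f^-1); split; first exact: tau_lwf.
  by rewrite -tauM divrr // tau1.
move=> /lwf_tau [g ->]; rewrite -tauM -tau1 => /tau_inj fg.
by rewrite -[g](mulKr fU) fg mulr1.
Qed.

Lemma tau_sums k (s : nat -> LR k) a : sums s a -> isum (fun j => tau (s j)) = tau a.
Proof.
elim: k s a => [|k IH] s a.
  move=> [N [sN ->]] /=.
  set Q := fun a : R => _; have [N' QN'] : Q (ClassicalEpsilon.epsilon (inhabits 0) Q).
    apply: ClassicalEpsilon.epsilon_spec; exists (\sum_(j < N) s j : LR 0); exists N => M NM.
    exact: (big_ord_vanish sN NM).
  rewrite -(QN' (N + N')%N); last by lia.
  exact: (big_ord_vanish sN (leq_addr _ _)).
by move=> [_ sa]; apply: funext => n /=; apply: (IH _ _ (sa n)).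
Qed.

Lemma tau_ser k c (g : LR k) : small g -> lsubst c (tau g) = tau (ser c g).
Proof.
move=> gs; rewrite -(tau_sums (serP c gs)); congr isum.
by apply: funext => j; rewrite -tau_cst tauX tauM.
Qed.

Lemma tau_y k l : (0 < l <= k)%N -> lvar R k l = tau (y R k l).
Proof.
elim: k => [|k IH] lk; first by lia.
case: (eqVneq l k.+1) => [lE|lk1]; rewrite !yE.
  rewrite lE lpowS_top /= eqxx; apply: funext => n.
  by case: eqP => _; rewrite ?tau1 ?tau0.
rewrite lpowS //= (negbTE lk1); apply: funext => n; rewrite yE in IH.
by case: eqP => _; rewrite ?tau0 // -IH //; lia.
Qed.

Lemma eq_coef k (f : LT k) e e' :
  (forall i, (0 < i <= k)%N -> e i = e' i) -> coef f e = coef f e'.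
Proof.
elim: k f => [//|k IH] f ee /=; rewrite ee; last by lia.
by apply: IH => i ik; apply: ee; lia.
Qed.

(** Extracting in the middle of the tower uses up slot l + 1 of the exponent vector, and the later
    slots move down by one. *)
Lemma coef_ext l k (f : LR k.+1) e : (l <= k)%N ->
  coef (tau f) e = coef (tau (ext l (e l.+1) f)) (fun i => if (i <= l)%N then e i else e i.+1).
Proof.
elim: k f => [|k IH] f lk; first by have -> : l = 0%N by lia.
case kl : (k < l)%N.
  rewrite ext_lt //; have -> : l = k.+1 by lia.
  transitivity (coef (tau ((f : lau (LR k.+1)) (e k.+2))) e); first by [].
  by apply: eq_coef => i ik; rewrite ifT //; lia.
transitivity (coef (tau ((f : lau (LR k.+1)) (e k.+2))) e); first by [].
rewrite IH; last by lia.
have -> : coef (tau (ext l (e l.+1) f)) (fun i => if (i <= l)%N then e i else e i.+1) =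
   coef (tau ((ext l (e l.+1) f : lau (LR k)) (e k.+2)))
        (fun i => if (i <= l)%N then e i else e i.+1).
  by rewrite /= [(k < l)%N]kl.
by rewrite ext_ge.
Qed.

(** * Logarithm, exponential and P as they appear in the statement *)

Section FormalGroupTransfer.
Variable m : nat -> R.
Local Notation lg := (logc m).
Local Notation ex := (expc m).

(** Evaluation at a variable loses nothing: an identity of series in y_1 gives back an identity of
    coefficient sequences. *)
Lemma ser_y1_coef c (n : nat) : (ser c (y R 1 1) : lau (LR 0)) n%:Z = c n.
Proof.
have [_ /(_ n%:Z)] := serP c (small_y R (isT : (0 < 1 <= 1)%N)).
move/(@sums_uniq R 0); apply; apply: eq_sums (@sums_delta R 0 (c n) n) => j.
rewrite LR_lconstM yE lpowX lpowS_top lmonoE natz.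
by rewrite eqz_nat eq_sym; case: eqP => [->|_]; rewrite ?mulr1 ?mulr0.
Qed.

(** A compositional inverse exists, so the specification given to [epsilon] is satisfiable and holds
    for the chosen sequence; it is an identity in y_1, which is then read off coefficientwise. *)
Lemma expc_spec : ex 0%N = 0 /\ seq_comp ex lg =1 @X_seq R.
Proof.
have y1s := small_y R (isT : (0 < 1 <= 1)%N).
have tE (e : nat -> R) : lsubst e (lsubst lg (lvar R 1 1)) = tau (ser (seq_comp e lg) (y R 1 1)).
  by rewrite tau_y // tau_ser // tau_ser ?ser_ser //; apply: small_ser.
pose Q (e : nat -> R) := e 0%N = 0 /\ lsubst e (lsubst lg (lvar R 1 1)) = lvar R 1 1.
have Qe : exists e, Q e.
  have [f [f0 fE]] := @comp_inv_exists R lg erefl erefl.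
  by exists f; split=> //; rewrite tE (ser_ext _ fE) ser_X tau_y.
have [] : Q ex := ClassicalEpsilon.epsilon_spec (inhabits (fun=> 0)) Q Qe.
move=> e0; rewrite tE tau_y // => /tau_inj exE; split=> // n.
by rewrite -(ser_y1_coef _ n) exE -[in LHS](ser_X (y R 1 1)) ser_y1_coef.
Qed.

Let ex0 : ex 0%N = 0 := expc_spec.1.
Let exlg := expc_spec.2.
Let lg0 : lg 0%N = 0 := erefl.
Let lg1 : lg 1%N = 1 := erefl.
Local Notation Lg := (Lg lg).
Local Notation Ex := (Ex ex).
Local Notation twisted := (twisted lg ex).
Local Notation tw_ratio := (tw_ratio lg ex).
Local Notation dlog_inv := (dlog_inv lg ex).

Let LgS k (z : LR k) : small z -> small (Lg z). Proof. exact: Lg_small. Qed.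
Let ExS k (z : LR k) : small z -> small (Ex z). Proof. exact: Ex_small. Qed.
Let LgExK k (z : LR k) : small z -> Lg (Ex z) = z. Proof. exact: LgEx. Qed.

Lemma tau_Lg k (a : LR k) : small a -> llog m (tau a) = tau (Lg a).
Proof. exact: tau_ser. Qed.

Lemma tau_Ex k (a : LR k) : small a -> lexpo m (tau a) = tau (Ex a).
Proof. exact: tau_ser. Qed.

Lemma tau_fgl k (a b : LR k) : small a -> small b ->
  fgl m (tau a) (tau b) = tau (Ex (Lg a + Lg b)).
Proof.
move=> as_ bs; have abs : small (Lg a + Lg b) by apply: smallD; apply: LgS.
by rewrite /fgl (tau_Lg as_) (tau_Lg bs) -tauD (tau_Ex abs).
Qed.

Lemma tau_fbar k (a : LR k) : small a -> fbar m (tau a) = tau (Ex (- Lg a)).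
Proof.
move=> as_; have nas := smallN (LgS as_).
by rewrite /fbar (tau_Lg as_) -tauN (tau_Ex nas).
Qed.

Lemma tau_fgl_bar k (a b : LR k) : small a -> small b ->
  fgl m (tau a) (fbar m (tau b)) = tau (twisted 1 a b).
Proof.
move=> as_ bs; have nbs := smallN (LgS bs).
by rewrite (tau_fbar bs) (tau_fgl as_ (ExS nbs)) (LgExK nbs) twistedE mul1r.
Qed.

Lemma tau_fgl_tmul k (a b : LR k.+1) : small a -> small b ->
  fgl m (tau a) (Defs.tmul m (fbar m (tau b))) = tau (twisted (y R k.+1 1) a b).
Proof.
move=> as_ bs; have nbs := smallN (LgS bs).
have tbs : small (y R k.+1 1 * - Lg b) by apply: smallMl => //; apply: valint_y1.
rewrite (tau_fbar bs) /Defs.tmul (tau_Lg (ExS nbs)) (LgExK nbs) tau_y // -tauM (tau_Ex tbs).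
by rewrite (tau_fgl as_ (ExS tbs)) (LgExK tbs) twistedE mulrN.
Qed.

Lemma tau_ratio k (a b : LR k.+1) : small a -> small b ->
  twisted 1 a b \is a GRing.unit -> Defs.ratio m (tau a) (tau b) = tau (tw_ratio a b).
Proof.
by move=> as_ bs U; rewrite /Defs.ratio tau_fgl_tmul // tau_fgl_bar // tauV // -tauM.
Qed.

(** The series with coefficients a_{i,1} is the coefficient of v in exp(log u + log v), namely
    exp'(log u). Here u = y_1 and v = y_2, and the expansion is made modulo v^2. *)
Lemma acoefE i : acoef m i = seq_comp (seq_deriv ex) lg i.
Proof.
have y1s := small_y R (isT : (0 < 1 <= 1)%N).
have y21s := small_y R (isT : (0 < 1 <= 2)%N).
have y22s := small_y R (isT : (0 < 2 <= 2)%N).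
pose A : LR 2 := Lg (y R 2 1); pose B : LR 2 := Lg (y R 2 2).
have As : small A by apply: Lg_small.
have Bs : small B by apply: Lg_small.
have cr := closed_regular R 1 2.
have rA : regular 1 A.
  apply: (csub_ser cr lg y21s); rewrite yE -(@ins_lpow_low R 1 1 1) //.
  exact: supp_ins.
have ry2 : regular 1 (y R 2 2) by rewrite yE; apply: supp_lpow.
have rB : regular 1 B by apply: (csub_ser cr lg y22s).
pose w' := dquot2 (y R 2 2) 0 lg.
have rw' : regular 1 w' := csub_dquot2 y22s (small0 R 2) lg cr ry2 (csub0 cr).
have BE : B = y R 2 2 + y R 2 2 * (y R 2 2 * w').
  have e1 := ser_dquot y22s (small0 R 2) lg.
  have e2 := dquot_dquot2 y22s (small0 R 2) lg.
  rewrite !ser0 /seq_deriv !rmorph0 !subr0 in e1 e2.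
  rewrite /B /Lg e1 -[dquot _ _ _](subrK (cst 2 (lg 1 *+ 1))) e2 mulr1n rmorph1.
  by rewrite mulrDr mulr1 addrC.
have ABs : small (A + B) by apply: smallD.
pose w := dquot2 (A + B) A ex.
have rw : regular 1 w := csub_dquot2 ABs As ex cr (csubD cr rA rB) rA.
pose S : LR 2 := dlog_inv (y R 2 1).
have SE : S = ins R 1 1 (dlog_inv (y R 1 1)) by rewrite ins_dlog_inv // !yE ins_lpow_low.
(* The multiple of y_2^2 is assembled from the two second-order remainders: w' for log at 0, and w
   for exp at A = log y_1. *)
have EAB : Ex (A + B) = y R 2 1 + S * y R 2 2 +
    lpow R 2 2 2 * (w' * S + (1 + y R 2 2 * w') * (1 + y R 2 2 * w') * w).
  have e1 := ser_dquot ABs As ex; have e2 := dquot_dquot2 ABs As ex.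
  have AB : A + B - A = B by rewrite addrC addrA addNr add0r.
  rewrite AB in e1 e2.
  have ExA : Ex A = y R 2 1 by apply: ExLg.
  have -> : Ex (A + B) = B * dquot (A + B) A ex + Ex A by apply/(canRL (subrK _))/e1.
  have -> : dquot (A + B) A ex = B * w + S by apply/(canRL (subrK _))/e2.
  rewrite ExA.
  have -> : lpow R 2 2 2 = y R 2 2 * y R 2 2 by rewrite yE lpowD.
  by rewrite BE; ring.
rewrite /acoef !tau_y // tau_fgl // -/A -/B EAB.
change (((y R 2 1 + S * y R 2 2 + lpow R 2 2 2 *
  (w' * S + (1 + y R 2 2 * w') * (1 + y R 2 2 * w') * w) : lau (LR 1)) 1 : lau (LR 0)) i%:Z =
  seq_comp (seq_deriv ex) lg i).
rewrite !LRD (_ : (y R 2 1 : lau (LR 1)) 1 = 0); last by rewrite yE lpowS.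
rewrite add0r lpowS_top LR_lmonoM mul1r.
set Q : LR 2 := _ + _; have rQ : regular 1 Q.
  have rc1 : regular 1 (1 + y R 2 2 * w') := csubD cr (csub1 cr) (csubM cr ry2 rw').
  have rS : regular 1 S by rewrite SE; apply: supp_ins.
  exact: (csubD cr (csubM cr rw' rS) (csubM cr (csubM cr rc1 rc1) rw)).
(* Behind the factor y_2^2, the coefficient of y_2 reads Q at exponent -1, where a regular series
   vanishes. *)
have -> : (Q : lau (LR 1)) (1 - 2) = 0 by apply: rQ.
rewrite addr0 SE mulrC yE lpowS_top LR_lmonoM mul1r subrr ins_lt // lconstE.
by rewrite dlog_invE ser_ser // ser_y1_coef.
Qed.

Lemma tau_Pser k (z : LR k) : small z -> Pser m (tau z) = tau (dlog_inv z).
Proof.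
move=> zs; rewrite /Pser; pose c := seq_comp (seq_deriv ex) lg.
(* [Pser] puts in its constant term 1 by hand and sums from i = 1 on; this agrees with the constant
   term exp'(0) = 1 of the composite. *)
have c0 : c 0%N = 1.
  by rewrite /c /seq_comp big_ord1 /seq_deriv (ex1 lg0 lg1 ex0 exlg) mulr1n /= mulr1.
have := sums_scons 0 (sums_behead (serP c zs)); rewrite add0r => /tau_sums.
set s1 := fun j => _; set s2 := fun i => _; have -> : s1 = s2.
  apply: funext => -[|j]; rewrite /s1 /s2 /= ?tau0 //.
  by rewrite tauM tau_cst exprS tauM tauX acoefE.
move->; rewrite -tau1 -tauD c0 rmorph1 expr0 mulr1 addrC subrK.
by rewrite dlog_invE ser_ser.
Qed.

End FormalGroupTransfer.
End Transfer.

(** * Coset representatives as rearrangements *)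

Section Arrangements.

(** An ordered choice of r elements, followed by the rest of J in its original order. For J = 0,
    ..., n-1 these are the words of the coset representatives. *)
Fixpoint arrangements (r : nat) (J : seq nat) : seq (seq nat) :=
  if r is r'.+1 then [seq j :: L | j <- J, L <- arrangements r' (rem j J)] else [:: J].

Lemma sorted_ltn_perm (J L : seq nat) : sorted ltn J -> sorted ltn L -> perm_eq L J -> L = J.
Proof.
move=> sJ sL; move/perm_mem; apply: (irr_sorted_eq ltn_trans ltnn sL sJ).
Qed.

Lemma sorted_rem (J : seq nat) j : sorted ltn J -> sorted ltn (rem j J).
Proof. exact: (subseq_sorted ltn_trans (rem_subseq j J)). Qed.

Lemma mem_arrangements r (J L : seq nat) : sorted ltn J -> (r <= size J)%N ->
  (L \in arrangements r J) = perm_eq L J && sorted ltn (drop r L).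
Proof.
elim: r J L => [|r IH] J L sJ rJ.
  rewrite drop0 inE; apply/eqP/andP => [->|[pL sL]]; first by rewrite perm_refl.
  exact: sorted_ltn_perm.
apply/allpairsPdep/andP => [[j [L' [jJ L'J ->]]]|[pL sL]].
  have sz : (r <= size (rem j J))%N by rewrite (size_rem jJ) -ltnS prednK //; apply: leq_trans rJ.
  move: L'J; rewrite IH ?sorted_rem // => /andP[pL' sL']; split=> //.
  by rewrite perm_sym (permPl (perm_to_rem jJ)) perm_cons perm_sym.
case: L pL sL => [pL|j L pL sL].
  by move: rJ; rewrite -(perm_size pL).
have jJ : j \in J by rewrite -(perm_mem pL) inE eqxx.
exists j, L; split=> //; rewrite IH ?sorted_rem //; last by rewrite (size_rem jJ) -ltnS prednK //; apply: leq_trans rJ.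
by rewrite sL andbT -(perm_cons j) (permPl pL) perm_to_rem.
Qed.

Lemma arrangements_uniq r (J : seq nat) : uniq J -> uniq (arrangements r J).
Proof.
elim: r J => // r IH J uJ /=; apply: allpairs_uniq_dep => // [j jJ|].
  by apply: IH; apply: rem_uniq.
by move=> [j L] [j' L'] _ _ /= [-> ->].
Qed.

Variables (A : comNzRingType) (f : nat -> nat -> A) (g : nat -> nat -> A).

Fixpoint weight (lam L : seq nat) : A :=
  match lam, L with
  | k :: lam', j :: L' => f j k * \prod_(l <- L') g j l * weight lam' L'
  | _, _ => 1
  end.

(** The nested form in which iterated residues deliver the sum: the factors g j l run over all
    indices not yet used, those chosen later as well as those never chosen. *)
Fixpoint arr_sum (lam J : seq nat) : A :=
  if lam is k :: lam' then
    \sum_(j <- J) f j k * \prod_(l <- rem j J) g j l * arr_sum lam' (rem j J)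
  else 1.

Lemma arr_sumE lam J : uniq J ->
  arr_sum lam J = \sum_(L <- arrangements (size lam) J) weight lam L.
Proof.
have weight_perm r (J' L : seq nat) : uniq J' -> L \in arrangements r J' -> perm_eq L J'.
  elim: r J' L => [|r IHr] J' L uJ' /=; first by rewrite inE => /eqP->.
  move=> /allpairsPdep[j [L' [jJ L'J ->]]].
  by rewrite perm_sym (permPl (perm_to_rem jJ)) perm_cons perm_sym IHr ?rem_uniq.
elim: lam J => [|k lam IH] J uJ /=; first by rewrite big_seq1.
rewrite big_allpairs_dep /=; apply: eq_bigr => j _.
rewrite IH ?rem_uniq // mulr_sumr; apply: eq_big_seq => L LJ /=.
by rewrite (perm_big _ (weight_perm _ _ _ (rem_uniq _ uJ) LJ)).
Qed.

Lemma weightE lam L : (size lam <= size L)%N ->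
  weight lam L = \prod_(0 <= i < size lam) f (nth 0%N L i) (nth 0%N lam i) *
    \prod_(0 <= i < size lam) \prod_(i.+1 <= j < size L) g (nth 0%N L i) (nth 0%N L j).
Proof.
elim: lam L => [|k lam IH] L; first by rewrite !big_geq // mulr1; case: L.
case: L => [//|j L] /= sz.
rewrite !(big_nat_recl (size lam)) //= IH // [\prod_(l <- L) _](big_nth 0%N) big_add1 /= mulrACA; congr (_ * (_ * _)).
by apply: eq_bigr => i _; rewrite [RHS]big_add1.
Qed.

End Arrangements.

(** * Permutations in one-line notation *)

Section CosetRepresentatives.
Variables (n r : nat).
Hypothesis rn : (r <= n)%N.

Definition perm_word (w : 'S_n) : seq nat := [seq (w i : nat) | i <- enum 'I_n].

Lemma nth_perm_word w (i : 'I_n) : nth 0%N (perm_word w) i = w i.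
Proof. by rewrite (nth_map i) ?size_enum_ord // nth_ord_enum. Qed.

Lemma size_perm_word w : size (perm_word w) = n.
Proof. by rewrite size_map size_enum_ord. Qed.

Lemma perm_word_inj : injective perm_word.
Proof.
by move=> w w' ww; apply/permP => i; apply: val_inj; rewrite /= -!nth_perm_word ww.
Qed.

Lemma perm_word_perm w : perm_eq (perm_word w) (iota 0 n).
Proof.
apply: uniq_perm; rewrite ?iota_uniq //.
  by rewrite map_inj_uniq ?enum_uniq // => i j /val_inj /perm_inj.
move=> i; rewrite mem_iota add0n; apply/mapP/idP => [[j _ ->]|/= il]; first exact: ltn_ord.
by exists (w^-1%g (Ordinal il)); rewrite ?mem_enum // permKV.
Qed.

Lemma perm_word_surj L : perm_eq L (iota 0 n) -> exists w, perm_word w = L.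
Proof.
move=> pL; have sL : size L = n by rewrite (perm_size pL) size_iota.
have lt (i : 'I_n) : (nth 0%N L i < n)%N.
  have : nth 0%N L i \in iota 0 n by rewrite -(perm_mem pL) mem_nth ?sL.
  by rewrite mem_iota.
have inj : injective (fun i => Ordinal (lt i)).
  move=> i j [] /eqP; rewrite nth_uniq ?sL //; first by move/eqP/val_inj.
  by rewrite (perm_uniq pL) iota_uniq.
exists (perm inj); apply: (@eq_from_nth _ 0%N); rewrite size_perm_word ?sL // => i il.
by rewrite (nth_perm_word _ (Ordinal il)) permE.
Qed.

Lemma cosetrep_sorted (w : 'S_n) : cosetrep r w = sorted ltn (drop r (perm_word w)).
Proof.
apply/forallP/(sortedP 0%N) => [H i|H i].
  rewrite size_drop size_perm_word => il.
  have i1 : (r + i < n)%N by lia.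
  have i2 : (r + i.+1 < n)%N by lia.
  have /forallP/(_ (Ordinal i2))/implyP := H (Ordinal i1).
  rewrite !nth_drop (nth_perm_word w (Ordinal i1)) (nth_perm_word w (Ordinal i2)); apply.
  by rewrite /=; lia.
apply/forallP => j; apply/implyP => /andP[ri ij].
have : sorted ltn (drop r (perm_word w)) by apply/(sortedP 0%N).
move/(sorted_ltn_nth ltn_trans 0%N)/(_ (i - r)%N (j - r)%N).
rewrite !inE size_drop size_perm_word !nth_drop !subnKC ?nth_perm_word; try lia.
by apply; have := ltn_ord i; have := ltn_ord j; lia.
Qed.

Lemma perm_arrangements :
  perm_eq [seq perm_word w | w <- enum [pred w : 'S_n | cosetrep r w]] (arrangements r (iota 0 n)).
Proof.
apply: uniq_perm.
- by rewrite map_inj_uniq ?enum_uniq //; apply: perm_word_inj.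
- by apply: arrangements_uniq; apply: iota_uniq.
move=> L; rewrite mem_arrangements ?iota_ltn_sorted ?size_iota //.
apply/mapP/andP => [[w + ->]|[pL sL]].
  by rewrite mem_enum inE cosetrep_sorted perm_word_perm.
have [w wL] := perm_word_surj pL; exists w => //.
by rewrite mem_enum inE cosetrep_sorted wL.
Qed.

Lemma sum_cosetrep (A : comNzRingType) (f g : nat -> nat -> A) (lam : seq nat) :
  size lam = r ->
  \sum_(w <- enum [pred w : 'S_n | cosetrep r w])
     (\prod_(i <- [seq i : 'I_n <- enum 'I_n | (i < r)%N]) f (w i) (nth 0%N lam i) *
      \prod_(p <- [seq p : 'I_n * 'I_n <- [seq (i, j) | i <- enum 'I_n, j <- enum 'I_n] |
                   ((p.1 < r)%N && (p.1 < p.2)%N)]) g (w p.1) (w p.2))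
  = arr_sum f g lam (iota 0 n).
Proof.
move=> lr; rewrite arr_sumE ?iota_uniq // lr -(perm_big _ perm_arrangements) big_map.
apply: eq_bigr => w _; rewrite weightE size_perm_word lr //.
set L := perm_word w; congr (_ * _).
  rewrite big_filter big_enum_cond /= (eq_bigr (fun i : 'I_n => f (nth 0%N L i) (nth 0%N lam i))).
    rewrite -(big_mkord (fun i => i < r)%N (fun i => f (nth 0%N L i) (nth 0%N lam i))).
    by rewrite (big_nat_widen _ _ _ _ _ rn).
  by move=> i _; rewrite nth_perm_word.
rewrite big_filter big_mkcond big_allpairs /= big_enum /=.
under eq_bigr do rewrite big_enum /=.
rewrite (big_nat_widen _ _ _ _ _ rn) big_mkord [RHS]big_mkcond; apply: eq_bigr => i _ /=.
case: ifP => ir; last by rewrite big1.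
rewrite -big_mkcond /= (big_nat_widenl _ 0%N) // big_mkord; apply: eq_big => [j|j ij]; first by [].
by rewrite !nth_perm_word.
Qed.

End CosetRepresentatives.

(** * Iterated residues *)

(** Separates the factors involving index 0, that is the variable u_1 to be extracted next, and
    renumbers the others. *)
Lemma prod_triangle_recl (A : comNzRingType) (F : nat -> A) (G : nat -> nat -> A) r :
  (\prod_(i <- iota 0 r.+1) F i) *
    \prod_(i <- iota 0 r.+1) \prod_(j <- iota 0 r.+1 | (i < j)%N) G i j =
  (F 0%N * \prod_(i <- iota 0 r) G 0%N i.+1) *
  ((\prod_(i <- iota 0 r) F i.+1) *
    \prod_(i <- iota 0 r) \prod_(j <- iota 0 r | (i < j)%N) G i.+1 j.+1).
Proof.
have -> : iota 0 r.+1 = 0%N :: [seq i.+1 | i <- iota 0 r] by rewrite /= (iotaDl 1 0).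
rewrite !big_cons /= !big_map mulrACA; congr (_ * _ * (_ * _)).
by apply: eq_bigr => i _; rewrite big_cons big_map.
Qed.

Lemma rmorph_div_eq (A B : comUnitRingType) (phi : {rmorphism A -> B}) a b a' b' :
  b \is a GRing.unit -> phi a = a' -> phi b = b' -> phi (a * b^-1) = a' * b'^-1.
Proof. by move=> bU <- <-; rewrite rmorphM rmorphV. Qed.

Lemma mul_ratioK (A : comUnitRingType) (d c a b : A) :
  a \is a GRing.unit -> b \is a GRing.unit -> d * (b * a^-1 * c) * (a * b^-1) = d * c.
Proof.
move=> aU bU; have -> : d * (b * a^-1 * c) * (a * b^-1) = d * c * ((a^-1 * a) * (b * b^-1)).
  by ring.
by rewrite mulVr // mulrV // !mulr1.
Qed.

Section CoefficientSum.
Variable R : comNzRingType.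
Local Notation LR := (LR R).
Variables lg ex : nat -> R.
Hypotheses (lg0 : lg 0%N = 0) (lg1 : lg 1%N = 1) (ex0 : ex 0%N = 0).
Hypothesis exlg : seq_comp ex lg =1 @X_seq R.
Local Notation twisted := (twisted lg ex).
Local Notation tw_ratio := (tw_ratio lg ex).
Local Notation dlog_inv := (dlog_inv lg ex).
Local Notation t k := (y R k 1).

Lemma y_sub_unit k a b : (0 < a <= k)%N -> (0 < b <= k)%N -> a != b ->
  y R k a - y R k b \is a GRing.unit.
Proof.
wlog ab : a b / (a < b)%N.
  move=> H ak bk ab; case: (ltngtP a b) => ab'; first exact: H.
    by rewrite -opprB unitrN; apply: H => //; rewrite eq_sym.
  by rewrite ab' eqxx in ab.
move=> ak bk _; have s : small (y R k b / y R k a) by apply: small_y_div; lia.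
have aU := y_unit R k a.
have -> : y R k a - y R k b = (1 - y R k b / y R k a) * y R k a.
  by rewrite mulrBl mul1r mulrVK.
rewrite unitrM aU andbT.
have hs : small (1 - y R k b / y R k a - 1).
  by rewrite addrC addrA addNr add0r; apply: smallN.
have hv := csubB (closed_valint R k) (valint1 R k) (small_valint s).
by have [] := cunit_in_small (closed_valint R k) hs hv.
Qed.

Lemma twisted1_y_unit k a b : (0 < a <= k)%N -> (0 < b <= k)%N -> a != b ->
  twisted 1 (y R k a) (y R k b) \is a GRing.unit.
Proof.
move=> ak bk ab.
exact: (twisted1_unit lg0 lg1 ex0 exlg (small_y R ak) (small_y R bk) (y_sub_unit ak bk ab)).
Qed.

Lemma twisted_y_unit k a b : (0 < a)%N -> (a < b <= k)%N ->
  twisted (t k) (y R k a) (y R k b) \is a GRing.unit.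
Proof.
move=> a0 ab; have as_ : small (y R k a) by apply: small_y; lia.
have bs : small (y R k b) by apply: small_y; lia.
have ts : small (t k) by apply: small_y; lia.
have s : small (y R k b / y R k a) by apply: small_y_div; lia.
have [h [-> vh hs]] := twisted_factor lg0 lg1 ex0 exlg (closed_valint R k)
  (small_valint ts) as_ bs (y_unit R k a) s (small_valint ts) (small_valint as_)
  (small_valint bs) (small_valint s).
by have [hU _ _] := cunit_in_small (closed_valint R k) hs vh; rewrite unitrM y_unit.
Qed.

Lemma twisted_self_unit k a : (0 < a <= k)%N ->
  twisted (t k) (y R k a) (y R k a) \is a GRing.unit.
Proof.
move=> ak; have as_ := small_y R ak.
have ts : small (t k) by apply: small_y; lia.
have [h [-> vh hs]] := twisted_self_factor lg0 lg1 ex0 exlg (closed_valint R k)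
  ts as_ (small_valint ts) (small_valint as_).
by have [hU _ _] := cunit_in_small (closed_valint R k) hs vh; rewrite unitrM y_unit.
Qed.

Lemma dlog_inv_y_unit k a : (0 < a <= k)%N -> dlog_inv (y R k a) \is a GRing.unit.
Proof.
move=> ak; have as_ := small_y R ak.
by have [] := dlog_inv_cunit lg0 lg1 ex0 exlg (closed_valint R k) as_ (small_valint as_).
Qed.

(** * The generating series and the removal of its first variable *)

Variables (first : bool) (n : nat).

(** The only difference between the two generating series: u/(u +_L [t](bar u)) for HP, 1 for HQ. *)
Definition unit_factor k (z : LR k) : LR k :=
  if first then z * (twisted (t k) z z)^-1 else 1.

(** The u have levels 2, ..., r + 1 in decreasing order of index, so that u_1 is the smallest of
    them. Inserting a new u_1 at level r + 2 therefore renumbers the old u_i as u_(i+1) without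
    moving them, and raises every x by one level. *)
Definition uvar r i : LR (r + n).+1 := y R (r + n).+1 (r.+1 - i).
Definition xvar r j : LR (r + n).+1 := y R (r + n).+1 (r.+2 + j).

(** J records which x_j still occur in the factors; those already selected remain variables of the
    ring. *)
Definition gen r (J : seq nat) : LR (r + n).+1 :=
  (\prod_(i <- iota 0 r) (unit_factor (uvar r i) * (dlog_inv (uvar r i))^-1 *
     \prod_(j <- J) tw_ratio (uvar r i) (xvar r j))) *
  \prod_(i <- iota 0 r) \prod_(j <- iota 0 r | (i < j)%N)
     (twisted 1 (uvar r j) (uvar r i) * (twisted (t _) (uvar r j) (uvar r i))^-1).

Section Insertion.
Variable r : nat.
Local Notation k := (r + n).+1.
Local Notation ins := (ins R r.+1 k).
Let l0 : (0 < r.+1 <= k)%N. Proof. by lia. Qed.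

Lemma ins_y_low a : (a <= r.+1)%N -> ins (y R k a) = y R k.+1 a.
Proof. by move=> ar; rewrite !yE; apply: ins_lpow_low => //; lia. Qed.

Lemma ins_y_high a : (r.+1 < a <= k)%N -> ins (y R k a) = y R k.+1 a.+1.
Proof. by move=> ar; rewrite !yE; apply: ins_lpow_high. Qed.

Lemma ins_uvar i : (i < r)%N -> ins (uvar r i) = uvar r.+1 i.+1.
Proof. by move=> ir; rewrite /uvar ins_y_low; [congr y; lia | lia]. Qed.

Lemma ins_xvar j : (j < n)%N -> ins (xvar r j) = xvar r.+1 j.
Proof. by move=> jn; rewrite /xvar ins_y_high; [congr y; lia | lia]. Qed.

Lemma ins_twisted_t (a b : LR k) : small a -> small b ->
  ins (twisted (t k) a b) = twisted (t k.+1) (ins a) (ins b).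
Proof.
move=> as_ bs; have := ins_twisted ex lg0 r.+1 (small_valint (small_y R (k := k) (l := 1) isT)) as_ bs.
by rewrite (ins_y1 R l0).
Qed.

Lemma ins_twisted1 (a b : LR k) : small a -> small b ->
  ins (twisted 1 a b) = twisted 1 (ins a) (ins b).
Proof.
move=> as_ bs; have := ins_twisted ex lg0 r.+1 (valint1 R k) as_ bs.
by rewrite rmorph1.
Qed.

Lemma ins_unit_factor a : (0 < a <= k)%N ->
  ins (unit_factor (y R k a)) = unit_factor (ins (y R k a)).
Proof.
move=> ak; rewrite /unit_factor; case: first; last by rewrite rmorph1.
have U := twisted_self_unit ak; have s := small_y R ak.
by rewrite rmorphM (rmorphV ins U) (ins_twisted_t s s).
Qed.

Lemma uvar_small i : (i < r)%N -> small (uvar r i).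
Proof. by move=> ir; apply: small_y; lia. Qed.

Lemma xvar_small j : (j < n)%N -> small (xvar r j).
Proof. by move=> jn; apply: small_y; lia. Qed.

Lemma gen_recl J : all (fun j => j < n)%N J ->
  gen r.+1 J =
  (unit_factor (uvar r.+1 0) * (dlog_inv (uvar r.+1 0))^-1 *
    \prod_(j <- J) tw_ratio (uvar r.+1 0) (ins (xvar r j)) *
    \prod_(z <- [seq uvar r i | i <- iota 0 r])
      (twisted 1 (ins z) (uvar r.+1 0) * (twisted (t k.+1) (ins z) (uvar r.+1 0))^-1)) *
  ins (gen r J).
Proof.
move=> /allP Jn.
pose F i := unit_factor (uvar r.+1 i) * (dlog_inv (uvar r.+1 i))^-1 *
  \prod_(j <- J) tw_ratio (uvar r.+1 i) (xvar r.+1 j).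
pose G i j := twisted 1 (uvar r.+1 j) (uvar r.+1 i) *
  (twisted (t k.+1) (uvar r.+1 j) (uvar r.+1 i))^-1.
have genE : ins (gen r J) = (\prod_(i <- iota 0 r) F i.+1) *
    \prod_(i <- iota 0 r) \prod_(j <- iota 0 r | (i < j)%N) G i.+1 j.+1.
  rewrite /gen rmorphM !rmorph_prod; congr (_ * _); apply: eq_big_seq => i;
    rewrite mem_iota add0n => /= ir.
    have ak : (0 < r.+1 - i <= k)%N by lia.
    have PU := dlog_inv_y_unit ak; have us := uvar_small ir.
    have e1 := ins_unit_factor ak; have e2 := ins_dlog_inv ex lg0 r.+1 us.
    rewrite -/(uvar r i) in PU e1; rewrite (ins_uvar ir) in e1 e2.
    rewrite !rmorphM rmorph_prod (rmorphV ins PU) e1 e2 /F.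
    congr (_ * _); apply: eq_big_seq => j /Jn jn.
    have U : twisted 1 (uvar r i) (xvar r j) \is a GRing.unit.
      by apply: twisted1_y_unit; lia.
    have e3 := ins_ratio lg0 l0 us (xvar_small jn) U.
    by rewrite (ins_uvar ir) (ins_xvar jn) in e3.
  rewrite rmorph_prod big_seq_cond [RHS]big_seq_cond; apply: eq_bigr => j.
  rewrite mem_iota add0n => /= /andP[jr ij].
  have us := uvar_small ir; have vs := uvar_small jr.
  have U : twisted (t k) (uvar r j) (uvar r i) \is a GRing.unit.
    by apply: twisted_y_unit; lia.
  have e1 := ins_twisted_t vs us; have e2 := ins_twisted1 vs us.
  rewrite (ins_uvar ir) (ins_uvar jr) in e1 e2.
  exact: (rmorph_div_eq U e2 e1).
have VE : \prod_(z <- [seq uvar r i | i <- iota 0 r])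
    (twisted 1 (ins z) (uvar r.+1 0) * (twisted (t k.+1) (ins z) (uvar r.+1 0))^-1) =
    \prod_(i <- iota 0 r) G 0%N i.+1.
  by rewrite big_map; apply: eq_big_seq => i; rewrite mem_iota => /= ir; rewrite ins_uvar.
have XE : \prod_(j <- J) tw_ratio (uvar r.+1 0) (ins (xvar r j)) =
    \prod_(j <- J) tw_ratio (uvar r.+1 0) (xvar r.+1 j).
  by apply: eq_big_seq => j /Jn jn; rewrite ins_xvar.
rewrite genE VE XE; exact: (prod_triangle_recl F G r).
Qed.

(** At u_1 = x_j the cross factor of u_1 with a remaining u_i becomes (u_i +_L bar x_j)/(u_i +_L
    [t](bar x_j)), the inverse of the ratio of u_i and x_j. *)
Lemma gen_cancel J j : all (fun j => j < n)%N J -> j \in J ->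
  gen r J * \prod_(z <- [seq uvar r i | i <- iota 0 r])
    (twisted 1 z (xvar r j) * (twisted (t k) z (xvar r j))^-1) = gen r (rem j J).
Proof.
move=> /allP Jn jJ; rewrite /gen mulrAC big_map prodM; congr (_ * _).
apply: eq_big_seq => i; rewrite mem_iota add0n => /= ir; rewrite (big_rem j jJ) /=.
have jn := Jn _ jJ.
have U1 : twisted 1 (uvar r i) (xvar r j) \is a GRing.unit.
  by apply: twisted1_y_unit; lia.
have Ut : twisted (t k) (uvar r i) (xvar r j) \is a GRing.unit.
  by apply: twisted_y_unit; lia.
exact: (mul_ratioK _ _ U1 Ut).
Qed.

(** Since u +_L [t](bar u) = u v with v a regular unit, the prefactor is 1/v, and u^-1 never has to
    be evaluated. The value of v at x_j is found by multiplying back by u, the case z = 0 of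
    [specializes_cancel]. *)
Lemma unit_factor_specializes j : (j < n)%N ->
  specializes r.+1 (xvar r j) (unit_factor (y R k.+1 r.+2)) (unit_factor (xvar r j)).
Proof.
move=> jn; rewrite /unit_factor; case: first; last first.
  by rewrite -(rmorph1 ins); apply: specializes_ins.
have lk : (r.+1 <= k)%N by lia.
have cr := closed_regular R r.+1 k.+1.
have us : small (y R k.+1 r.+2) by apply: small_y; lia.
have ts : small (t k) by apply: small_y.
have ts' : small (t k.+1) by apply: small_y.
have xs := xvar_small jn.
have ru := reg_u R lk.
have rt : regular r.+1 (t k.+1) by rewrite -(ins_y1 R l0); apply: reg_ins.
have [v [uv rv vs]] := twisted_self_factor lg0 lg1 ex0 exlg cr ts' us rt ru.
have [w [xw vw ws]] := twisted_self_factor lg0 lg1 ex0 exlg (closed_valint R k) ts xs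
  (small_valint ts) (small_valint xs).
have vC := cunit_in_small cr vs rv; have [vU _ _] := vC.
have [wU _ _] := cunit_in_small (closed_valint R k) ws vw.
have xU : xvar r j \is a GRing.unit := y_unit R k (r.+2 + j).
have uU := y_unit R k.+1 r.+2.
have cancel (A : comUnitRingType) (a b : A) : a \is a GRing.unit -> b \is a GRing.unit ->
    a * (a * b)^-1 = b^-1.
  by move=> aU bU; rewrite invrM // mulrCA mulrV // mulr1.
rewrite uv xw (cancel _ _ _ uU vU) (cancel _ _ _ xU wU).
apply: (specializesV lk vC wU).
have x0U : xvar r j - 0 \is a GRing.unit by rewrite subr0.
apply: (specializes_cancel lk x0U rv).
rewrite rmorph0 !subr0 mulrC -uv mulrC -xw -(ins_y1 R l0).
by apply: (specializes_twisted ex lg0 l0 (small_valint ts) us us xs xs); apply: specializes_u.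
Qed.

Lemma unit_factor_regular : regular r.+1 (unit_factor (y R k.+1 r.+2)).
Proof.
have lk : (r.+1 <= k)%N by lia.
have cr := closed_regular R r.+1 k.+1.
rewrite /unit_factor; case: first; last exact: csub1.
have us : small (y R k.+1 r.+2) by apply: small_y; lia.
have ts' : small (t k.+1) by apply: small_y.
have rt : regular r.+1 (t k.+1) by rewrite -(ins_y1 R l0); apply: reg_ins.
have [v [uv rv vs]] := twisted_self_factor lg0 lg1 ex0 exlg cr ts' us rt (reg_u R lk).
have [vU _ rV] := cunit_in_small cr vs rv.
by rewrite uv invrM ?y_unit // mulrCA mulrV ?y_unit // mulr1.
Qed.

Lemma ext_gen p J : all (fun j => j < n)%N J -> uniq J ->
  ext r.+1 (- p.+1%:Z) (gen r.+1 J) =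
  \sum_(j <- J) unit_factor (xvar r j) * twisted (t k) (xvar r j) (xvar r j) * xvar r j ^+ p *
    \prod_(i <- rem j J) tw_ratio (xvar r j) (xvar r i) * gen r (rem j J).
Proof.
move=> Jn uJ; rewrite gen_recl // mulrC ext_insM.
have Jlt j : j \in J -> (j < n)%N by move/(allP Jn).
have uE : uvar r.+1 0 = y R k.+1 r.+2 by rewrite /uvar subn0.
have xs : {in J, forall j, small (xvar r j)} by move=> j /Jlt; apply: xvar_small.
have xus : {in J, forall j, small (ins (xvar r j) / y R k.+1 r.+2)}.
  move=> j /Jlt jn; rewrite ins_xvar //; apply: small_y_div; lia.
have xU : {in J &, forall i j, i != j -> xvar r i - xvar r j \is a GRing.unit}.
  move=> i j /Jlt iN /Jlt jn ij; apply: y_sub_unit; lia.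
have Vs : {in [seq uvar r i | i <- iota 0 r], forall z,
    [/\ small z, z \is a GRing.unit & small (y R k.+1 r.+2 / ins z)]}.
  move=> z /mapP[i]; rewrite mem_iota add0n => /= ir ->.
  split; [exact: uvar_small | exact: (y_unit R k (r.+1 - i)) |].
  rewrite ins_uvar //; have ai : (0 < r.+2 - i.+1 < r.+2)%N by lia.
  by apply: (small_y_div R (k := k.+1) ai); lia.
have xVs : {in [seq uvar r i | i <- iota 0 r] & J, forall z j, small (xvar r j / z)}.
  move=> z j /mapP[i]; rewrite mem_iota add0n => /= ir -> /Jlt jn.
  have ai : (0 < r.+1 - i < r.+2 + j)%N by lia.
  by apply: (small_y_div R (k := k) ai); lia.
have fuP : {in J, forall j, specializes r.+1 (xvar r j)
    (unit_factor (y R k.+1 r.+2)) (unit_factor (xvar r j))}.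
  by move=> j /Jlt; apply: unit_factor_specializes.
have step := residue_sum lg0 lg1 ex0 exlg l0 uJ xs xus xU Vs xVs fuP unit_factor_regular p.
rewrite uE step mulr_sumr; apply: eq_big_seq => j jJ.
by rewrite mulrCA gen_cancel.
Qed.

End Insertion.

(** The variable u_1, at level [size lam'] + 2, goes first with exponent -lam_1; the remaining
    series then has the shape required for lam'. *)
Fixpoint extract (lam : seq nat) : LR (size lam + n).+1 -> LR n.+1 :=
  match lam return LR (size lam + n).+1 -> LR n.+1 with
  | [::] => id
  | k :: lam' => fun f => extract (ext (size lam').+1 (- k%:Z) f)
  end.

Lemma extract_is_additive lam : additive (@extract lam).
Proof.
elim: lam => [//|k lam IH] f g.
exact: etrans (congr1 (@extract lam) (ext_is_additive _ _ f g)) (IH _ _).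
Qed.
HB.instance Definition _ lam := GRing.isZmodMorphism.Build
  (LR (size lam + n).+1) (LR n.+1) (@extract lam) (@extract_is_additive lam).

Fixpoint ins_iter (r : nat) : {rmorphism LR n.+1 -> LR (r + n).+1} :=
  match r return {rmorphism LR n.+1 -> LR (r + n).+1} with
  | 0 => idfun
  | r'.+1 => (ins R r'.+1 (r' + n).+1 \o ins_iter r' : {rmorphism LR n.+1 -> LR (r'.+1 + n).+1})
  end.

Lemma extract_insM lam a (f : LR (size lam + n).+1) :
  extract (ins_iter (size lam) a * f) = a * extract f.
Proof.
elim: lam f => [//|k lam IH] f.
exact: etrans (congr1 (@extract lam) (ext_insM _ _ _ f)) (IH _).
Qed.

Lemma ins_iterS r a : ins_iter r.+1 a = ins R r.+1 (r + n).+1 (ins_iter r a).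
Proof. by []. Qed.

Lemma ins_iter_x r j : (j < n)%N -> ins_iter r (xvar 0 j) = xvar r j.
Proof. by move=> jn; elim: r => // r IH; rewrite ins_iterS IH ins_xvar. Qed.

Lemma ins_iter_tw_t r i j : (i < n)%N -> (j < n)%N ->
  ins_iter r (twisted (t _) (xvar 0 i) (xvar 0 j)) = twisted (t _) (xvar r i) (xvar r j).
Proof.
move=> iN jN; elim: r => // r IH.
by rewrite ins_iterS IH ins_twisted_t ?ins_xvar //; apply: xvar_small.
Qed.

Lemma ins_iter_unit_factor r j : (j < n)%N ->
  ins_iter r (unit_factor (xvar 0 j)) = unit_factor (xvar r j).
Proof.
move=> jn; elim: r => // r IH.
by rewrite ins_iterS IH ins_unit_factor -/(xvar r j) ?ins_xvar //; lia.
Qed.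

Lemma ins_iter_ratio r i j : (i < n)%N -> (j < n)%N -> i != j ->
  ins_iter r (tw_ratio (xvar 0 i) (xvar 0 j)) = tw_ratio (xvar r i) (xvar r j).
Proof.
move=> iN jn ij; elim: r => // r IH; rewrite ins_iterS IH.
have U : twisted 1 (xvar r i) (xvar r j) \is a GRing.unit by apply: twisted1_y_unit; lia.
have l0 : (0 < r.+1 <= (r + n).+1)%N by lia.
by rewrite (ins_ratio lg0 l0 (xvar_small r iN) (xvar_small r jn) U) !ins_xvar.
Qed.

(** For k > 0 this is x_j^k in the case of HP, where the prefactor cancels the middle term, and
    [x_j;t]^k in the case of HQ. *)
Definition monomial j k : LR n.+1 :=
  unit_factor (xvar 0 j) * twisted (t _) (xvar 0 j) (xvar 0 j) * xvar 0 j ^+ k.-1.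

(** Each residue step matches one level of the nested sum. Positivity of the parts enters because
    residues give the coefficients of exponents -k with k at least 1. *)
Lemma extract_gen lam J : all (fun k => 0 < k)%N lam -> all (fun j => j < n)%N J -> uniq J ->
  extract (gen (size lam) J) =
  arr_sum monomial (fun i j => tw_ratio (xvar 0 i) (xvar 0 j)) lam J.
Proof.
elim: lam J => [|k lam IH] J.
  by move=> _ _ _; rewrite /= /gen !big_nil mulr1.
case: k => [//|p] /andP[_ /IH {}IH] Jn uJ.
rewrite [arr_sum _ _ _ _]/=.
transitivity (extract (ext (size lam).+1 (- p.+1%:Z) (gen (size lam).+1 J))); first by [].
rewrite (ext_gen _ p Jn uJ) raddf_sum; apply: eq_big_seq => j jJ.
have Jlt i : i \in J -> (i < n)%N by move/(allP Jn).
have jn := Jlt j jJ.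
have Jn' : all (fun j => j < n)%N (rem j J) by apply/allP => i /mem_rem /Jlt.
rewrite -(IH _ Jn' (rem_uniq _ uJ)) -extract_insM; congr (extract (_ * _)).
rewrite /monomial !rmorphM rmorphXn rmorph_prod.
rewrite (ins_iter_unit_factor _ jn) (ins_iter_tw_t _ jn jn) (ins_iter_x _ jn).
congr (_ * _); apply: eq_big_seq => i; rewrite mem_rem_uniq // inE => /andP[ij iJ].
by rewrite (ins_iter_ratio _ jn (Jlt _ iJ)) // eq_sym.
Qed.

End CoefficientSum.

(** * Proof of the theorem *)

Section Main.
Variables (R : comNzRingType) (m : nat -> R).
Local Notation LR := (LR R).
Local Notation lg := (logc m).
Local Notation ex := (expc m).
Let ex0 : ex 0%N = 0 := (expc_spec m).1.
Let exlg := (expc_spec m).2.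
Let lg0 : lg 0%N = 0 := erefl.
Let lg1 : lg 1%N = 1 := erefl.

Lemma tau_twistedV k (a b : LR k.+1) : small a -> small b ->
  twisted lg ex (y R k.+1 1) a b \is a GRing.unit ->
  linv (fgl m (tau a) (Defs.tmul m (fbar m (tau b)))) = tau (twisted lg ex (y R k.+1 1) a b)^-1.
Proof. by move=> as_ bs U; rewrite (tau_fgl_tmul m as_ bs) (tauV U). Qed.

Lemma tau_first (first : bool) k a : (0 < a <= k.+1)%N ->
  (if first then lmul (lvar R k.+1 a) (linv (fgl m (lvar R k.+1 a)
      (Defs.tmul m (fbar m (lvar R k.+1 a))))) else lone R k.+1) =
  tau (unit_factor lg ex first (y R k.+1 a)).
Proof.
move=> ak; have s := small_y R ak; rewrite /unit_factor; case: first; last by rewrite tau1.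
rewrite (tau_y R ak) (tau_twistedV s s) ?tauM //.
exact: (twisted_self_unit lg0 lg1 ex0 exlg ak).
Qed.

Lemma tau_ratio_y k a b : (0 < a <= k.+1)%N -> (0 < b <= k.+1)%N -> a != b ->
  Defs.ratio m (lvar R k.+1 a) (lvar R k.+1 b) = tau (tw_ratio lg ex (y R k.+1 a) (y R k.+1 b)).
Proof.
move=> ak bk ab; rewrite (tau_y R ak) (tau_y R bk).
apply: (tau_ratio (small_y R ak) (small_y R bk)).
exact: (twisted1_y_unit lg0 lg1 ex0 exlg ak bk ab).
Qed.

Variable n : nat.

Lemma GenF_tau lam first : (size lam <= n)%N ->
  GenF m n lam first = tau (gen lg ex first n (size lam) (iota 0 n)).
Proof.
move=> rn; rewrite /GenF; set r := size lam in rn *.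
rewrite /gen tauM; congr lmul.
  apply: tau_prod => i; rewrite mem_iota add0n => /andP[_ ir].
  have ak : (0 < r.+1 - i <= (r + n).+1)%N by lia.
  have PU := dlog_inv_y_unit lg0 lg1 ex0 exlg ak.
  rewrite !tauM (tau_first _ ak); congr (lmul (lmul _ _) _).
    by rewrite (tau_y R ak) (tau_Pser m (small_y R ak)) (tauV PU).
  apply: tau_prod => j; rewrite mem_iota add0n => /andP[_ jn].
  by apply: tau_ratio_y; lia.
set s := [seq p : nat * nat <- _ | _].
have -> : \prod_(i <- iota 0 r) \prod_(j <- iota 0 r | (i < j)%N)
    (twisted lg ex 1 (uvar R n r j) (uvar R n r i) *
     (twisted lg ex (y R (r + n).+1 1) (uvar R n r j) (uvar R n r i))^-1) =
  \prod_(p <- s) (twisted lg ex 1 (uvar R n r p.2) (uvar R n r p.1) *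
     (twisted lg ex (y R (r + n).+1 1) (uvar R n r p.2) (uvar R n r p.1))^-1).
  rewrite /s [RHS]big_filter [RHS]big_mkcond [RHS]big_allpairs; apply: eq_bigr => i _.
  by rewrite [LHS]big_mkcond.
apply: tau_prod => -[i j]; rewrite mem_filter => /andP[ij /allpairsP[[i' j'] []]].
rewrite !mem_iota !add0n => /andP[_ ir] /andP[_ jr] [ii jj].
rewrite -{}ii -{}jj in ir jr; rewrite /fst /snd in ij ir jr *.
have ak : (0 < r.+1 - i <= (r + n).+1)%N by lia.
have bk : (0 < r.+1 - j <= (r + n).+1)%N by lia.
have sa := small_y R ak; have sb := small_y R bk.
have U : twisted lg ex (y R (r + n).+1 1) (uvar R n r j) (uvar R n r i) \is a GRing.unit.
  by apply: (twisted_y_unit lg0 lg1 ex0 exlg); lia.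
rewrite tauM (tau_y R ak) (tau_y R bk); congr lmul; first exact: (tau_fgl_bar m sb sa).
exact: (tau_twistedV sb sa U).
Qed.

Lemma HL_tau lam first (mono : LT R n.+1 -> nat -> LT R n.+1) :
  (forall j k, (j < n)%N -> (0 < k)%N ->
     mono (lvar R n.+1 j.+2) k = tau (monomial lg ex first n j k)) ->
  all (fun k => 0 < k)%N lam -> (size lam <= n)%N ->
  HL m lam mono = tau (arr_sum (monomial lg ex first n)
     (fun i j => tw_ratio lg ex (xvar R n 0 i) (xvar R n 0 j)) lam (iota 0 n)).
Proof.
move=> monoE /allP lam0 rn; rewrite -(sum_cosetrep rn) //.
apply: tau_sum_in => w _; rewrite tauM; congr lmul.
  apply: tau_prod => i; rewrite mem_filter => /andP[ir _].
  by apply: monoE => //; apply: lam0; apply: mem_nth.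
apply: tau_prod => -[i j]; rewrite mem_filter /fst /snd => /andP[/andP[ir ij] _].
have il := ltn_ord (w i); have jl := ltn_ord (w j).
apply: tau_ratio_y; [lia | lia |].
rewrite !eqSS; apply: contraTneq ij => /val_inj/perm_inj ->.
by rewrite ltnn.
Qed.

(** Deleting the slot of u_1 from the exponent vector of k :: lam gives that of lam: the slots below
    belong to the other u, those above to the x, which move down by one. *)
Lemma uexp_cons k lam e i : (0 < i <= size lam + n.+1)%N ->
  (if (i <= (size lam).+1)%N then uexp (k :: lam) e i else uexp (k :: lam) e i.+1) =
  uexp lam e i.
Proof.
rewrite /uexp /= => i0; case: ifP => i1.
  case: ifP => // i2; rewrite ifT ?i1; last by lia.
  by rewrite (_ : (size lam).+2 - i = ((size lam).+1 - i).+1)%N //; lia.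
rewrite !ifF; try lia.
by congr e; lia.
Qed.

Lemma coef_extract lam (f : LR (size lam + n).+1) e :
  coef (tau f) (uexp lam e) = coef (tau (@extract R n lam f)) e.
Proof.
elim: lam f => [|k lam IH] f.
  apply: eq_coef => i ik; rewrite /uexp /= subn0; case: ifP => // i1.
  by rewrite ifF //; lia.
rewrite (@coef_ext R (size lam).+1 (size lam + n).+1 f); last by lia.
rewrite [RHS](_ : _ = coef (tau (@extract R n lam (ext (size lam).+1 (- k%:Z) f))) e) //.
rewrite -IH (_ : uexp (k :: lam) e (size lam).+2 = - k%:Z); last first.
  by rewrite /uexp /= ltnSn subnn.
by apply: eq_coef => i ik; rewrite uexp_cons //; lia.
Qed.

End Main.

Theorem mainTheorem10 (R : comNzRingType) (m : nat -> R) (n : nat) (lam : seq nat) :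
  sorted geq lam -> all (fun k => 0 < k)%N lam -> (size lam <= n)%N ->
  (forall e : nat -> int,
     coef (HPL m n lam) e = coef (GenF m n lam true) (uexp lam e)) /\
  (forall e : nat -> int,
     coef (HQL m n lam) e = coef (GenF m n lam false) (uexp lam e)).
Proof.
move=> _ lam0 rn.
have [ex0 exlg] := expc_spec m.
have lg0 : logc m 0%N = 0 by []. have lg1 : logc m 1%N = 1 by [].
have iota_lt : all (fun j => j < n)%N (iota 0 n).
  by apply/allP => j; rewrite mem_iota.
have genE first e : coef (GenF m n lam first) (uexp lam e) =
    coef (tau (arr_sum (monomial (logc m) (expc m) first n)
     (fun i j => tw_ratio (logc m) (expc m) (xvar R n 0 i) (xvar R n 0 j)) lam (iota 0 n))) e.
  rewrite GenF_tau // coef_extract.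
  by rewrite (extract_gen lg0 lg1 ex0 exlg first lam0 iota_lt (iota_uniq 0 n)).
have lvarE j : (j < n)%N -> lvar R n.+1 j.+2 = tau (xvar R n 0 j).
  by move=> jn; rewrite tau_y //; lia.
split=> e; rewrite genE; congr coef; apply: HL_tau => // j k jn k0.
  rewrite (lvarE _ jn) tauX /monomial /unit_factor; congr tau.
  (* Invertibility of x_j +_L [t](bar x_j) allows it to cancel against the prefactor of HP, which
     leaves x_j times x_j^(k-1). *)
  have U : twisted (logc m) (expc m) (y R n.+1 1) (xvar R n 0 j) (xvar R n 0 j) \is a GRing.unit.
    by apply: (twisted_self_unit lg0 lg1 ex0 exlg); lia.
  by rewrite (mulrVK U) -exprS prednK.
have xs : small (xvar R n 0 j) by apply: small_y; lia.
rewrite (lvarE _ jn) /tpow (tau_fgl_tmul m xs xs) tauX -tauM /monomial /unit_factor.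
by rewrite mul1r.
Qed.
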